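(* Let $\mathbb K$ be an algebraically closed field (of arbitrary characteristic), let $\mathbb V$ be a vector space over $\mathbb K$ with $\dim\mathbb V\ge2$, and let $\mathfrak g=\mathfrak{gl}(\mathbb V)$. Then for any nilpotent element $e\in\mathfrak g$, the set $(\mathfrak g_e^* )_{\rm sing}$ has codimension $\ge 2$ in $\mathfrak g_e^*$.
   Context: $\mathfrak g_e$ is the centraliser of $e$ in $\mathfrak g$. For a finite-dimensional Lie algebra $\mathfrak q$ and $\gamma\in\mathfrak q^*$, $\mathfrak q^\gamma=\{x\in\mathfrak q:\gamma([x,\mathfrak q])=0\}$, ${\rm ind}\,\mathfrak q=\min_\gamma\dim\mathfrak q^\gamma$, and $(\mathfrak q^* )_{\rm sing}=\{\gamma\in\mathfrak q^*:\dim\mathfrak q^\gamma>{\rm ind}\,\mathfrak q\}$. *)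

(* Defs.v *)
From HB Require Import structures.
From mathcomp Require Import all_boot all_order all_algebra.
From mathcomp Require Import mpoly.
Set Implicit Arguments. Unset Strict Implicit. Unset Printing Implicit Defensive.
Import GRing.Theory.
Local Open Scope ring_scope.

(* Coordinates of w in the canonical basis vbasis {:W}; polynomial functions on W
   are polynomials in these coordinates (independent of the basis choice). *)
Definition coords (K : fieldType) (W : vectType K) (w : W) : 'I_(\dim {:W}) -> K :=
  fun i => coord (vbasis fullv) i w.

Definition polyfun (K : fieldType) (W : vectType K) (p : {mpoly K[\dim {:W}]}) (w : W) : K :=
  p.@[coords w].

Definition zclosed (K : fieldType) (W : vectType K) (Z : W -> Prop) : Prop :=
  exists S : {mpoly K[\dim {:W}]} -> Prop,
    forall w, Z w <-> (forall p, S p -> polyfun p w = 0).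

Definition zirreducible (K : fieldType) (W : vectType K) (Z : W -> Prop) : Prop :=
  zclosed Z /\ (exists w, Z w) /\
  forall Z1 Z2 : W -> Prop, zclosed Z1 -> zclosed Z2 ->
    (forall w, Z w -> Z1 w \/ Z2 w) ->
    (forall w, Z w -> Z1 w) \/ (forall w, Z w -> Z2 w).

Definition zclosure (K : fieldType) (W : vectType K) (X : W -> Prop) : W -> Prop :=
  fun w => forall p : {mpoly K[\dim {:W}]},
    (forall x, X x -> polyfun p x = 0) -> polyfun p w = 0.

Definition zdim_le (K : fieldType) (W : vectType K) (X : W -> Prop) (d : nat) : Prop :=
  forall (k : nat) (Z : nat -> W -> Prop),
    (forall i, (i <= k)%N -> zirreducible (Z i)) ->
    (forall i, (i < k)%N ->
       (forall w, Z i w -> Z i.+1 w) /\ (exists w, Z i.+1 w /\ ~ Z i w)) ->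
    (forall w, Z k w -> zclosure X w) ->
    (k <= d)%N.

Definition zcodim_ge (K : fieldType) (W : vectType K) (X : W -> Prop) (c : nat) : Prop :=
  (c <= \dim {:W})%N /\ zdim_le X (\dim {:W} - c).

Definition lie (K : fieldType) (n : nat) (x y : 'M[K]_n) : 'M[K]_n :=
  x *m y - y *m x.

Definition centraliser (K : fieldType) (n : nat) (e : 'M[K]_n) : {vspace 'M[K]_n} :=
  lker (linfun (fun x : 'M[K]_n => lie x e)).

Definition dual_ge (K : fieldType) (n : nat) (e : 'M[K]_n) : vectType K :=
  'Hom(subvs_of (centraliser e), K^o).

Definition stab (K : fieldType) (n : nat) (e : 'M[K]_n) (gamma : dual_ge e)
  : {vspace subvs_of (centraliser e)} :=
  lker (linfun (fun x : subvs_of (centraliser e) =>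
          (linfun (fun y : subvs_of (centraliser e) =>
             (gamma (vsproj (centraliser e) (lie (vsval x) (vsval y))) : K^o))
           : 'Hom(subvs_of (centraliser e), K^o)))).

(* sing(g_e dual) = { gamma | dim g_e^gamma > ind g_e = min_gamma' dim g_e^gamma' } *)
Definition sing (K : fieldType) (n : nat) (e : 'M[K]_n) : dual_ge e -> Prop :=
  fun gamma => exists gamma' : dual_ge e, (\dim (stab gamma') < \dim (stab gamma))%N.

(* Main.v *)
Require Import Defs.
From Stdlib Require Import Classical.
From HB Require Import structures.
From mathcomp Require Import all_boot all_order all_algebra.
From mathcomp Require Import mpoly.
From mathcomp Require Import zify.
Import GRing.Theory.
Local Open Scope ring_scope.

Set Implicit Arguments. Unset Strict Implicit. Unset Printing Implicit Defensive.

(**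
Every [gamma] has [dim g_e^gamma >= n] (Vinberg), so on the singular locus all
Gram minors of size [r = dim g_e - n] of the form [gamma([x, y])] vanish.
Writing the space as a sum of Jordan chains generated by [v_i] of nonincreasing
lengths, with dual generators [psi_i], put [alpha(x) = sum_i a_i v_i x psi_i]
with distinct nonzero [a_i], and [beta(x) = sum_i v_i x psi_(i+1)]. The form of
[alpha + t beta] is nondegenerate on the off-diagonal part of [g_e] for every
[t], being triangular for the grading by [j - i]; hence the Gram determinant of
that part restricts to [c u^r] on the plane [u alpha + v beta]. On the other
hand the stabiliser of [beta] has dimension [n], because [x |-> x psi_0] is
injective on it, so some other Gram determinant does not vanish at [beta].

These two homogeneous equations eliminate all high powers of the two
coordinates [u] and [v], so polynomials of degree at most [d] restricted to the
closure of the singular locus span a space of dimension [O(d^(N-2))], [N] being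
the dimension of [g_e]. A chain [Z_0 < ... < Z_k] of irreducible closed subsets
forces at least [c d^k] independent polynomials on [Z_k]: if [p_t] are
independent on [Z_i] and [g] vanishes on [Z_i] but not on [Z_(i+1)], then the
[p_t g^j] are independent on [Z_(i+1)]. Therefore [k <= N - 2].
*)

(** * Chains of irreducible closed sets and growth of functions *)

Lemma row_dependence (K : fieldType) (a b : nat) (A : 'M[K]_(a, b)) :
  (b < a)%N -> exists2 c : 'rV[K]_a, c != 0 & c *m A = 0.
Proof.
move=> ltba; have /rowV0Pn [c cA c0] : kermx A != 0.
  rewrite kermx_eq0 /row_free; apply/eqP => rA.
  by have := rank_leq_col A; rewrite rA leqNgt ltba.
by exists c => //; apply/sub_kermxP.
Qed.

(** * Normal forms modulo two homogeneous equations *)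

Section Reduction.
Variables (K : fieldType) (N r : nat) (i0 i1 : 'I_N) (I : {mpoly K[N]} -> Prop).
Hypothesis ID : forall p q, I p -> I q -> I (p + q).
Hypothesis IM : forall p q, I q -> I (p * q).
Variables f g : {mpoly K[N]}.
Hypotheses (If : I f) (Ig : I g).
Hypothesis f_lead : f@_(U_(i0) *+ r) != 0.
Hypothesis g_lead : g@_(U_(i1) *+ r) != 0.
Hypothesis f_supp : forall m, m \in msupp f ->
  mdeg m = r /\ (m = (U_(i0) *+ r)%MM \/ (m i0 + m i1 < r)%N).
Hypothesis g_supp : forall m, m \in msupp g -> mdeg m = r.
Hypothesis i01 : i0 != i1.

Definition reducible_to d (p : {mpoly K[N]}) := exists2 q, I (p - q) &
  forall m, m \in msupp q -> [/\ (mdeg m <= d)%N, (m i0 < r)%N & (m i1 < r)%N].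

Let I0 : I 0.
Proof. by rewrite -(mul0r f); apply: IM. Qed.

Let IZ c p : I p -> I (c *: p).
Proof. by move=> Ip; rewrite -mul_mpolyC; apply: IM. Qed.

Lemma reducible0 d : reducible_to d 0.
Proof. by exists 0; rewrite ?subrr // => m; rewrite msupp0. Qed.

Lemma reducibleD d p q : reducible_to d p -> reducible_to d q -> reducible_to d (p + q).
Proof.
move=> [p' Ip hp] [q' Iq hq]; exists (p' + q').
  by rewrite opprD addrACA; apply: ID.
by move=> m /msuppD_le; rewrite mem_cat => /orP[/hp | /hq].
Qed.

Lemma reducibleZ d c p : reducible_to d p -> reducible_to d (c *: p).
Proof.
move=> [p' Ip hp]; exists (c *: p'); first by rewrite -scalerBr; apply: IZ.
by move=> m /msuppZ_le /hp.
Qed.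

Lemma reducible_sum d (T : eqType) (s : seq T) (F : T -> {mpoly K[N]}) :
  (forall x, x \in s -> reducible_to d (F x)) -> reducible_to d (\sum_(x <- s) F x).
Proof.
elim: s => [|x s IH] H; first by rewrite big_nil; apply: reducible0.
rewrite big_cons; apply: reducibleD; first by apply: H; rewrite mem_head.
by apply: IH => y ys; apply: H; rewrite inE ys orbT.
Qed.

(** One rewriting step: modulo [I] the monomial [u] is a combination of the other monomials of [h],
    so it may be replaced by them inside [m]. *)
Lemma reducible_rewrite d (h : {mpoly K[N]}) (u m : 'X_{1..N}) :
  I h -> h@_u != 0 -> (u <= m)%MM ->
  (forall m', m' \in msupp h -> m' != u -> reducible_to d 'X_[(m - u) + m']) ->
  reducible_to d 'X_[m].
Proof.
move=> Ih hu um H.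
have uh : u \in msupp h by rewrite mcoeff_msupp.
pose S := \sum_(m' <- rem u (msupp h)) h@_m' *: 'X_[m'] : {mpoly K[N]}.
have hE : h = h@_u *: 'X_[u] + S.
  by rewrite {1}[h]mpolyE (perm_big _ (perm_to_rem uh)) big_cons.
have [q Iq hq] : reducible_to d ('X_[m - u] * (- (h@_u)^-1 *: S)).
  rewrite -scalerAr mulr_sumr; apply/reducibleZ/reducible_sum => m' m'h.
  rewrite -scalerAr -mpolyXD; apply/reducibleZ.
  by move: m'h; rewrite mem_rem_uniq // inE => /andP[? ?]; apply: H.
exists q => //.
rewrite -[X in X - q](subrK ('X_[m - u] * (- (h@_u)^-1 *: S))) -addrA.
apply: ID => //.
rewrite -{1}(submK um) mpolyXD -mulrBr; apply: IM.
have -> : 'X_[u] - (- (h@_u)^-1 *: S) = (h@_u)^-1 *: h.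
  move: hE hu; set c := h@_u => -> c0.
  by rewrite scalerDr scalerA mulVf // scale1r scaleNr opprK.
exact: IZ.
Qed.

Lemma mulm_lower i (m : 'X_{1..N}) : (r <= m i)%N -> (U_(i) *+ r <= m)%MM.
Proof.
move=> h; apply/mnm_lepP => j; rewrite mulmnE mnm1E.
by case: eqP => [<-|_]; rewrite ?mul1n ?mul0n.
Qed.

(* Rewriting with [f] lowers [m i0 + m i1]; rewriting with [g] either lowers it too, or keeps it
   and lowers [m i1]. *)
Lemma reducible_mnm d m : (mdeg m <= d)%N -> reducible_to d 'X_[m].
Proof.
have [s hs] := ubnP (m i0 + m i1); elim: s => // s IHs in m hs *.
have [t ht] := ubnP (m i1); elim: t => // t IHt in m hs ht *.
move=> md.
have [ge0 | lt0] := leqP r (m i0).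
  apply: (reducible_rewrite If f_lead (mulm_lower ge0)) => m' /f_supp[dm' [-> | lt']].
    by rewrite eqxx.
  move=> _; have e0 : (m - U_(i0) *+ r)%MM i0 = (m i0 - r)%N.
    by rewrite mnmBE mulmnE mnm1E eqxx mul1n.
  have e1 : (m - U_(i0) *+ r)%MM i1 = m i1.
    by rewrite mnmBE mulmnE mnm1E (negPf i01) mul0n subn0.
  apply: IHs; first by rewrite !mnmDE e0 e1; lia.
  rewrite mdegD dm'; have := submK (mulm_lower ge0) => /(congr1 mdeg).
  by rewrite mdegD mdegMn mdeg1 mul1n => ->.
have [ge1 | lt1] := leqP r (m i1); last first.
  exists 'X_[m]; first by rewrite subrr.
  by move=> m'; rewrite msuppX inE => /eqP ->.
apply: (reducible_rewrite Ig g_lead (mulm_lower ge1)) => m' /g_supp dm' m'N.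
have e1 : (m - U_(i1) *+ r)%MM i1 = (m i1 - r)%N.
  by rewrite mnmBE mulmnE mnm1E eqxx mul1n.
have e0 : (m - U_(i1) *+ r)%MM i0 = m i0.
  by rewrite mnmBE mulmnE mnm1E eq_sym (negPf i01) mul0n subn0.
have dE : mdeg (m - U_(i1) *+ r + m') = mdeg m.
  rewrite mdegD dm'; have := submK (mulm_lower ge1) => /(congr1 mdeg).
  by rewrite mdegD mdegMn mdeg1 mul1n => ->.
have le' : (m' i0 + m' i1 <= r)%N.
  rewrite -dm' mdegE (bigD1 i0) //= (bigD1 i1) 1?eq_sym //=.
  by rewrite addnA leq_addr.
have lt' : (m' i1 < r)%N.
  have le1 : (m' i1 <= r)%N by lia.
  rewrite ltn_neqAle le1 andbT; apply: contra m'N => /eqP m'1.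
  apply/eqP/mnmP => j; rewrite mulmnE mnm1E.
  case: eqP => [<- | /eqP ji]; first by rewrite mul1n.
  move: dm'; rewrite mdegE (bigD1 i1) //= m'1 (bigD1 j) 1?eq_sym //=; lia.
apply: IHt; rewrite ?mnmDE ?e0 ?e1 ?dE //; lia.
Qed.

Lemma reducible_all d p : (forall m, m \in msupp p -> (mdeg m <= d)%N) ->
  reducible_to d p.
Proof.
move=> H; rewrite [p]mpolyE; apply: reducible_sum => m /H md.
exact/reducibleZ/reducible_mnm.
Qed.

(** A box containing the normal monomials: only single exponents are bounded, not the total degree,
    so that the count is a product. *)
Definition normal_mnms d : seq 'X_{1..N} :=
  [seq [multinom (x i : nat) | i < N] | x : {ffun 'I_N -> 'I_d.+1}
    in family (fun i : 'I_N => [pred y : 'I_d.+1 | (i \in [:: i0; i1]) ==> (y < r)%N])].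

Lemma mem_normal_mnms d (m : 'X_{1..N}) :
  (mdeg m <= d)%N -> (m i0 < r)%N -> (m i1 < r)%N -> m \in normal_mnms d.
Proof.
move=> md m0 m1.
have mi i : (m i < d.+1)%N.
  by rewrite ltnS; apply: leq_trans md; rewrite mdegE (bigD1 i) //= leq_addr.
apply/imageP; exists [ffun i => Ordinal (mi i)]; last first.
  by apply/mnmP => i; rewrite mnmE ffunE.
apply/familyP => i; rewrite inE ffunE /=; apply/implyP.
by rewrite !inE => /orP[] /eqP ->.
Qed.

(** Two of the [N] sides of the box have length at most [r] independently of [d]; this saves two
    powers of [d.+1]. *)
Lemma size_normal_mnms d : (size (normal_mnms d) <= r ^ 2 * d.+1 ^ (N - 2))%N.
Proof.
rewrite size_image card_family.
set A := fun i : 'I_N => _.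
have -> : foldr muln 1%N [seq A i | i : 'I_N] = (\prod_(i < N) A i)%N.
  by rewrite foldrE big_map enumT.
have Ar i : i \in [:: i0; i1] -> (A i <= r)%N.
  move=> ii; rewrite /A -[X in (_ <= X)%N](size_iota 0).
  rewrite cardE -(size_map val); apply: uniq_leq_size.
    by rewrite map_inj_uniq ?enum_uniq //; apply: val_inj.
  move=> z /mapP[y]; rewrite mem_enum inE ii /= => yr ->.
  by rewrite mem_iota.
rewrite (bigD1 i0) //= (bigD1 i1) 1?eq_sym //= mulnA leq_mul //.
  by rewrite -mulnn leq_mul // Ar // !inE eqxx ?orbT.
have -> : (N - 2 = #|[pred i : 'I_N | (i != i0) && (i != i1)]|)%N.
  have := cardC (pred2 i0 i1); rewrite card2 i01 card_ord => NE.
  transitivity #|[predC pred2 i0 i1]|; first by rewrite -[X in (X - _)%N]NE addKn.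
  by apply: eq_card => i; rewrite !inE negb_or.
rewrite -prod_nat_const; apply: leq_prod => i _.
by rewrite /A -[X in (_ <= X)%N](card_ord d.+1) max_card.
Qed.

(** The normal forms [q t] have fewer monomials available than there are indices [t], so they
    satisfy a linear relation, which the [p t] inherit modulo [I]. *)
Lemma dependent_mod (T : finType) d (p : T -> {mpoly K[N]}) :
  (forall t m, m \in msupp (p t) -> (mdeg m <= d)%N) ->
  (r ^ 2 * d.+1 ^ (N - 2) < #|T|)%N ->
  exists2 c : T -> K, (exists t, c t != 0) & I (\sum_t c t *: p t).
Proof.
move=> pd lt.
have /fin_all_exists [q qP] : forall t, exists q, I (p t - q) /\
    forall m, m \in msupp q -> m \in normal_mnms d.
  move=> t; have [q Iq hq] := reducible_all (pd t); exists q; split => // m /hq[*].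
  exact: mem_normal_mnms.
pose s := undup (normal_mnms d).
have ss : (size s < #|T|)%N.
  by apply: leq_ltn_trans lt; apply: leq_trans (size_normal_mnms d); apply: size_undup.
pose A := \matrix_(i < #|T|, j < size s) (q (enum_val i))@_(nth 0%MM s j).
have [c c0 cA] := row_dependence A ss.
exists (fun t => c 0 (enum_rank t)).
  have /rV0Pn [j cj] := c0; exists (enum_val j); by rewrite enum_valK.
have q0 : \sum_t c 0 (enum_rank t) *: q t = 0.
  apply/mpolyP => m; rewrite raddf_sum mcoeff0 /=.
  have [ms | ms] := boolP (m \in s).
    have lts : (index m s < size s)%N by rewrite index_mem.
    have := congr1 (fun M : 'rV_(size s) => M 0 (Ordinal lts)) cA.
    rewrite !mxE => E; apply: etrans E; rewrite [RHS](reindex (@enum_rank T)) /=; last first.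
      by apply: onW_bij; exact: enum_rank_bij.
    by apply: eq_bigr => t _; rewrite !mxE enum_rankK mcoeffZ /= nth_index.
  apply: big1 => t _; rewrite mcoeffZ memN_msupp_eq0 ?mulr0 //.
  by apply: contra ms => /((qP t).2); rewrite mem_undup.
rewrite -[X in I X]subr0 -[X in _ - X]q0 -sumrB.
by apply: big_ind => // t _; rewrite -scalerBr; apply/IZ/(qP t).1.
Qed.

End Reduction.

(** * Degree bounds and linear changes of coordinates *)

Definition degree_le (K : fieldType) (n d : nat) (p : {mpoly K[n]}) :=
  forall m, m \in msupp p -> (mdeg m <= d)%N.

Lemma degree_le1 (K : fieldType) n : degree_le 0 (1 : {mpoly K[n]}).
Proof. by move=> m; rewrite msupp1 inE => /eqP ->; rewrite mdeg0. Qed.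

Lemma degree_leM (K : fieldType) n d1 d2 (p q : {mpoly K[n]}) :
  degree_le d1 p -> degree_le d2 q -> degree_le (d1 + d2) (p * q).
Proof.
move=> hp hq m /msuppM_le /allpairsP [[m1 m2] [/= /hp h1 /hq h2 ->]].
by rewrite mdegD leq_add.
Qed.

Lemma degree_leX (K : fieldType) n d (p : {mpoly K[n]}) k :
  degree_le d p -> degree_le (d * k) (p ^+ k).
Proof.
move=> hp; elim: k => [|k IH]; first by rewrite muln0; apply: degree_le1.
by rewrite exprS mulnS; apply: degree_leM.
Qed.

Lemma degree_le_trans (K : fieldType) n d d' (p : {mpoly K[n]}) :
  (d <= d')%N -> degree_le d p -> degree_le d' p.
Proof. by move=> le hp m /hp h; apply: leq_trans le. Qed.

Lemma degree_le_msize (K : fieldType) n (p : {mpoly K[n]}) : degree_le (msize p) p.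
Proof. by move=> m /msize_mdeg_lt /ltnW. Qed.

(** Closed sets are defined in the canonical coordinates, while the equations are simple only in an
    adapted basis; this translates between the two without raising degrees. *)
Lemma linear_substitution (K : fieldType) n1 n2 (A : 'I_n1 -> 'I_n2 -> K) d
    (p : {mpoly K[n1]}) : degree_le d p ->
  exists2 q : {mpoly K[n2]}, degree_le d q &
    forall v, q.@[v] = p.@[fun i => \sum_j A i j * v j].
Proof.
move=> hp; pose l : n1.-tuple {mpoly K[n2]} := [tuple \sum_j A i j *: 'X_j | i < n1].
have hl i : degree_le 1 (tnth l i).
  rewrite tnth_mktuple => m /msupp_sum_le /flattenP[s /mapP[j _ ->]] /msuppZ_le.
  by rewrite msuppX inE => /eqP ->; rewrite mdeg1.
exists (p \mPo l); last first.
  move=> v; rewrite comp_mpoly_meval; apply: meval_eq => i.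
  rewrite tnth_mktuple raddf_sum /=; apply: eq_bigr => j _.
  by rewrite mevalZ mevalXU.
rewrite comp_mpolyEX => m /msupp_sum_le /flattenP[s /mapP[u]].
rewrite mem_filter /= => up -> /msuppZ_le.
move: m; apply: (degree_le_trans (hp u up)).
rewrite comp_mpolyX mdegE; apply: (big_ind2 (fun p e => degree_le e p)).
- exact: degree_le1.
- by move=> p1 d1 p2 d2; apply: degree_leM.
move=> i _; by rewrite -[X in degree_le X]mul1n; apply: degree_leX.
Qed.

(** * Independent functions on the members of a chain *)

Section Chains.
Variables (K : fieldType) (W : vectType K).
Implicit Types (Z X : W -> Prop) (p q : {mpoly K[\dim {:W}]}).

Definition vanishes_on Z p := forall w, Z w -> polyfun p w = 0.

(** The zero loci of [p] and [q] are closed and together cover [Z]. *)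
Lemma zirreducible_prime Z p q : zirreducible Z -> vanishes_on Z (p * q) ->
  vanishes_on Z p \/ vanishes_on Z q.
Proof.
move=> [_ [_ irr]] pq.
have zc h : zclosed (fun w : W => polyfun h w = 0).
  by exists (eq h) => w; split => [? _ <- // | ]; apply.
apply: irr => // w /pq; rewrite /polyfun mevalM => /eqP.
by rewrite mulf_eq0 => /orP[/eqP | /eqP]; [left | right].
Qed.

Definition free_on Z (T : finType) (p : T -> {mpoly K[\dim {:W}]}) :=
  forall c : T -> K, vanishes_on Z (\sum_t c t *: p t) -> forall t, c t = 0.

(** Read a relation as a polynomial in [g] whose coefficients are combinations of the [p t].
    Restriction to [Z] isolates the constant coefficient, which vanishes by freeness; then one
    factor [g] is cancelled on [Z'] and the argument repeats. *)
Lemma free_on_mul_powers Z Z' (T : finType) (p : T -> {mpoly K[\dim {:W}]}) g d :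
  zirreducible Z' -> (forall w, Z w -> Z' w) ->
  vanishes_on Z g -> ~ vanishes_on Z' g -> free_on Z p ->
  free_on Z' (fun tj : T * 'I_d => p tj.1 * g ^+ tj.2).
Proof.
move=> irr ZZ' gZ gZ' frp c.
have -> : \sum_t c t *: (p t.1 * g ^+ t.2) =
    \sum_(j < d) (\sum_t c (t, j) *: p t) * g ^+ j.
  under [RHS]eq_bigr do rewrite mulr_suml.
  rewrite exchange_big pair_big /=.
  by apply: eq_bigr => -[t j] _ /=; rewrite scalerAl.
move=> H; suff Hj : forall j, vanishes_on Z (\sum_t c (t, j) *: p t).
  by move=> [t j]; exact: frp (fun t => c (t, j)) (Hj j) t.
elim: d c H => [|d IH] c H j; first by case: j.
move: H; rewrite big_ord_recl expr0 mulr1 => H.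
have H0 : vanishes_on Z (\sum_t c (t, ord0) *: p t).
  move=> w Zw; have := H w (ZZ' w Zw); rewrite /polyfun mevalD.
  rewrite [X in _ + X](_ : _ = 0) ?addr0 // raddf_sum big1 // => i _ /=.
  by rewrite mevalM rmorphXn /= [meval _ g](gZ w Zw) expr0n /= mulr0.
have c0 : \sum_t c (t, ord0) *: p t = 0.
  by apply: big1 => t _; rewrite (frp (fun t => c (t, ord0)) H0) scale0r.
case: (unliftP ord0 j) => [j' -> | -> //].
apply: (IH (fun tj => c (tj.1, lift ord0 tj.2))).
(* Without its constant term the relation is divisible by [g]; as [g] does not vanish on the
   irreducible [Z'], the cofactor does. *)
have : vanishes_on Z' (g * \sum_(i < d) (\sum_t c (t, lift ord0 i) *: p t) * g ^+ i).
  move=> w /H; rewrite c0 add0r => <-; congr polyfun; rewrite mulr_sumr.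
  by apply: eq_bigr => i _; rewrite exprS mulrCA.
by case/(zirreducible_prime irr).
Qed.

(** Each inclusion contributes the powers up to [d] of one equation separating the two sets. [D]
    adds up the sizes of these equations and so does not depend on [d]. *)
Lemma chain_free (k : nat) (Z : nat -> W -> Prop) :
  (forall i, (i <= k)%N -> zirreducible (Z i)) ->
  (forall i, (i < k)%N ->
    (forall w, Z i w -> Z i.+1 w) /\ (exists w, Z i.+1 w /\ ~ Z i w)) ->
  exists D, forall d, exists (T : finType) (p : T -> {mpoly K[\dim {:W}]}),
    [/\ #|T| = (d.+1 ^ k)%N, forall t, degree_le (D * d) (p t) & free_on (Z k) p].
Proof.
elim: k => [|k IH] irr str.
  exists 0%N => d; exists unit, (fun _ => 1); split.
  - by rewrite card_unit.
  - by move=> _; apply: degree_le1.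
  move=> c; have [_ [[w Zw] _]] := irr 0%N (leqnn _).
  move/(_ w Zw); rewrite /polyfun (big_pred1 tt) => [|[]//].
  by rewrite mevalZ meval1 mulr1 => c0 [].
have [||D HD] := IH; [by move=> i ik; apply/irr/leqW | by move=> i /leqW; apply: str |].
have [ZZ' [w [Z'w nZw]]] := str k (leqnn _).
have [[S SP] _] := irr k (leqnSn _).
(* If every equation of [Z k] vanished at [w], then [w] would lie in [Z k]. *)
have [g Sg gw] : exists2 g, S g & polyfun g w <> 0.
  apply: NNPP => H; apply: nZw; apply/SP => g Sg; apply: NNPP => gw.
  by apply: H; exists g.
exists (D + msize g)%N => d; have [T [p [cT dp frp]]] := HD d.
exists (T * 'I_d.+1)%type, (fun tj : T * 'I_d.+1 => p tj.1 * g ^+ tj.2); split.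
- by rewrite card_prod card_ord cT expnSr.
- move=> [t j] /=; rewrite mulnDl; apply: degree_leM => //.
  apply: (@degree_le_trans _ _ (msize g * j)).
    by rewrite leq_mul2l -ltnS ltn_ord orbT.
  exact/degree_leX/degree_le_msize.
apply: free_on_mul_powers ZZ' _ _ frp; first exact: irr.
  by move=> x /SP; apply.
by move/(_ w Z'w).
Qed.

(** Growth comparison on [Z k]: [d.+1 ^ k] independent functions of degree at most [D * d] against
    [r ^ 2 * (D * d).+1 ^ (N - 2)] normal monomials. *)
Lemma codim2_criterion X (r : nat) (b : (\dim {:W}).-tuple W)
    (i0 i1 : 'I_(\dim {:W})) (f g : {mpoly K[\dim {:W}]}) :
  basis_of fullv b -> i0 != i1 ->
  (forall w, X w -> f.@[fun i => coord b i w] = 0) ->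
  (forall w, X w -> g.@[fun i => coord b i w] = 0) ->
  f@_(U_(i0) *+ r) != 0 -> g@_(U_(i1) *+ r) != 0 ->
  (forall m, m \in msupp f ->
    mdeg m = r /\ (m = (U_(i0) *+ r)%MM \/ (m i0 + m i1 < r)%N)) ->
  (forall m, m \in msupp g -> mdeg m = r) ->
  zdim_le X (\dim {:W} - 2).
Proof.
set N := \dim {:W} => bb i01 fX gX f_lead g_lead f_supp g_supp k Z irr str ZX.
have changeE (b1 b2 : N.-tuple W) w : basis_of fullv b2 ->
    (fun i => coord b1 i w) =1 (fun i => \sum_(j < N) coord b1 i b2`_j * coord b2 j w).
  move=> bb2 i; rewrite {1}(coord_basis bb2 (memvf w)) raddf_sum.
  by apply: eq_bigr => j _ /=; rewrite linearZ /= mulrC.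
have to_new d p : degree_le d p -> exists2 q, degree_le d q &
    forall w : W, q.@[fun i => coord b i w] = polyfun p w.
  move=> /(linear_substitution
    (fun i (j : 'I_N) => coord (vbasis fullv) i b`_j))[q dq qE]; exists q => // w.
  by rewrite qE /polyfun /coords; apply: meval_eq => i; rewrite -changeE.
(* Equations of [X] pass to [Z k], which lies in the closure of [X], once rewritten in the canonical
   coordinates. *)
have vanish h : (forall w, X w -> h.@[fun i => coord b i w] = 0) ->
    forall w, Z k w -> h.@[fun i => coord b i w] = 0.
  have [q _ qE] := linear_substitution (fun i (j : 'I_N) => coord b i (vbasis fullv)`_j)
    (@degree_le_msize _ _ h).
  have qE' w : polyfun q w = h.@[fun i => coord b i w].
    rewrite /polyfun qE; apply: meval_eq => i; rewrite -(changeE b (vbasis fullv)) //.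
    exact: vbasisP.
  by move=> hX w /ZX Zw; rewrite -qE'; apply: Zw => x /hX; rewrite qE'.
pose I (p : {mpoly K[N]}) := forall w, Z k w -> p.@[fun i => coord b i w] = 0.
have ID p q : I p -> I q -> I (p + q).
  by move=> Ip Iq w Zw; rewrite mevalD Ip // Iq // addr0.
have IM p q : I q -> I (p * q) by move=> Iq w Zw; rewrite mevalM Iq // mulr0.
have [D HD] := chain_free irr str.
have bound d : (d.+1 ^ k <= r ^ 2 * (D * d).+1 ^ (N - 2))%N.
  have [T [p [cT dp frp]]] := HD d; rewrite -cT leqNgt; apply/negP => lt.
  have /fin_all_exists [q qP] : forall t, exists q, degree_le (D * d) q /\
      forall w : W, q.@[fun i => coord b i w] = polyfun (p t) w.
    by move=> t; have [q] := to_new _ _ (dp t); exists q.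
  have [c [t ct] Ic] := dependent_mod ID IM (vanish f fX) (vanish g gX)
    f_lead g_lead f_supp g_supp i01 (fun t => (qP t).1) lt.
  case/eqP: ct; apply: frp => w /Ic <-; rewrite /polyfun !raddf_sum /=.
  by apply: eq_bigr => u _; rewrite !mevalZ (qP u).2.
rewrite leqNgt; apply/negP => ltk.
(* Taking [d = C] contradicts [bound] when [N - 2 < k]: its right side is at most
   [C * C.+1 ^ (N - 2)], which is smaller than [C.+1 ^ (N - 2).+1]. *)
pose C := (r ^ 2 * D.+1 ^ (N - 2))%N.
have := bound C; apply/negP; rewrite -ltnNge.
apply: (@leq_ltn_trans (C * C.+1 ^ (N - 2))); last first.
  apply: (@leq_trans (C.+1 ^ (N - 2).+1)); last by rewrite leq_pexp2l.
  by rewrite expnS ltn_pmul2r // expn_gt0.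
have -> : (C * C.+1 ^ (N - 2) = r ^ 2 * (D.+1 * C.+1) ^ (N - 2))%N.
  by rewrite expnMn mulnA.
rewrite leq_mul2l; apply/orP; right.
have [-> // | Npos] := posnP (N - 2); rewrite leq_exp2r //; lia.
Qed.

End Chains.

(** * Leading coefficients of homogeneous polynomials and determinants *)

Lemma mnm_eq_mulU n (m : 'X_{1..n}) i : (forall j, j != i -> m j = 0%N) ->
  m = (U_(i) *+ mdeg m)%MM.
Proof.
move=> m0; apply/mnmP => j; rewrite mulmnE mnm1E mdegE (bigD1 i) //=.
rewrite big1 => [|k /m0 //]; rewrite addn0.
by case: eqVneq => [<- | ne]; rewrite ?mul1n // m0 // eq_sym.
Qed.

(** At a coordinate vector every monomial of degree [r] vanishes except the pure power of that
    coordinate. *)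
Lemma lead_coef_homog_point (K : fieldType) (N r : nat) (i1 : 'I_N) (g : {mpoly K[N]}) :
  g \is r.-homog -> g.@[fun i => (i == i1)%:R] != 0 -> g@_(U_(i1) *+ r) != 0.
Proof.
move=> hg; apply: contraNneq => g0; rewrite mevalE big_seq big1 // => m mg.
have md : mdeg m = r by move/dhomogP: hg; apply.
have [/existsP[j /andP[ji mj]] | /existsPn none] :=
  boolP [exists j, (j != i1) && (m j != 0%N)].
  by rewrite (bigD1 j) //= (negPf ji) expr0n (negPf mj) mul0r mulr0.
have mE : m = (U_(i1) *+ mdeg m)%MM.
  apply: mnm_eq_mulU => j ji; apply/eqP.
  by have := none j; rewrite ji /= negbK.
by rewrite mE md g0 mul0r.
Qed.

(* Restricted to the plane of [i0] and [i1], [f] becomes a binary form whose dehomogenisation has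
   no root, hence a monomial. *)
Lemma lead_coef_homog_line (K : closedFieldType) (N r : nat) (i0 i1 : 'I_N)
    (f : {mpoly K[N]}) :
  i0 != i1 -> f \is r.-homog ->
  (forall v : K, f.@[fun i => (i == i0)%:R + v * (i == i1)%:R] != 0) ->
  f@_(U_(i0) *+ r) != 0 /\
  (forall m, m \in msupp f ->
    mdeg m = r /\ (m = (U_(i0) *+ r)%MM \/ (m i0 + m i1 < r)%N)).
Proof.
move=> i01 hf nz; have i10 : i1 != i0 by rewrite eq_sym.
have md m : m \in msupp f -> mdeg m = r by move/dhomogP: hf; apply.
have sumE (m : 'X_{1..N}) :
    mdeg m = (m i0 + m i1 + \sum_(i < N | (i != i0) && (i != i1)) m i)%N.
  by rewrite mdegE (bigD1 i0) //= (bigD1 i1) //= addnA.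
have others (m : 'X_{1..N}) j : j != i0 -> j != i1 ->
    (m i0 + m i1)%N = mdeg m -> m j = 0%N.
  move=> j0 j1; rewrite sumE => /eqP; rewrite -[X in X == _]addn0 eqn_add2l eq_sym.
  by rewrite sum_nat_eq0 => /forallP /(_ j); rewrite j0 j1 => /eqP.
pose h : {poly K} := \sum_(m <- msupp f | (m i0 + m i1 == r)%N) f@_m *: 'X^(m i1).
have hE v : h.[v] = f.@[fun i => (i == i0)%:R + v * (i == i1)%:R].
  rewrite mevalE horner_sum big_mkcond /=; apply: eq_big_seq => m mf.
  case: eqP => [mr | mr].
    rewrite hornerZ hornerXn; congr (_ * _).
    rewrite (bigD1 i0) //= (bigD1 i1) //= big1 => [|j /andP[j0 j1]].
      rewrite !eqxx (negPf i01) (negPf i10) mulr0 addr0 expr1n mul1r.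
      by rewrite add0r !mulr1.
    by rewrite (others m j j0 j1) ?md.
  have [j /andP[/andP[j0 j1] mj]] : exists j, (j != i0) && (j != i1) && (m j != 0%N).
    apply/existsP; apply: contraPT mr => /existsPn none.
    suff -> : r = (m i0 + m i1)%N by [].
    rewrite -(md m mf) sumE big1 ?addn0 // => j /andP[j0 j1].
    by apply/eqP; have := none j; rewrite j0 j1 /= negbK.
  rewrite (bigD1 j) //= (negPf j0) (negPf j1) mulr0 addr0 expr0n (negPf mj).
  by rewrite mul0r mulr0.
have h1 : size h == 1%N.
  rewrite -[_ == _]negbK; apply/closed_rootP => -[v]; rewrite /root hE.
  by rewrite (negPf (nz v)).
have mE (m : 'X_{1..N}) : m \in msupp f -> m i0 = r -> m = (U_(i0) *+ r)%MM.
  move=> mf m0; rewrite -(md m mf); apply: mnm_eq_mulU => j j0.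
  have m1 : m i1 = 0%N by move: (md m mf); rewrite sumE m0; lia.
  case: (eqVneq j i1) => [-> // | j1]; apply: others => //.
  by rewrite m1 addn0 m0 md.
split.
  apply: lead_coef_homog_point => //; have := nz 0; congr (_ != 0).
  by apply: meval_eq => i; rewrite mul0r addr0.
move=> m mf; rewrite md //; split => //.
have [lt | ge] := ltnP (m i0 + m i1) r; first by right.
left; have mr : (m i0 + m i1)%N = r.
  by apply/eqP; rewrite eqn_leq ge andbT -(md m mf) sumE leq_addr.
apply: mE => //; suff : m i1 = 0%N by lia.
apply/eqP; rewrite -leqn0 leqNgt; apply/negP => m1.
(* No other monomial contributes to this coefficient: on the plane the exponents at [i0] and [i1]
   add up to [r] and all others are zero. *)
have : h`_(m i1) = f@_m.
  rewrite coef_sum -big_filter (bigD1_seq m) /=; last 2 first.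
  - by rewrite mem_filter mr eqxx.
  - by rewrite filter_uniq.
  rewrite coefZ coefXn eqxx mulr1 big_seq_cond big1 ?addr0 // => m'.
  rewrite mem_filter => /andP[/andP[/eqP mr' mf'] ne].
  rewrite coefZ coefXn; case: eqP => [E | _]; last by rewrite mulr0.
  case/eqP: ne; apply/mnmP => j.
  case: (eqVneq j i1) => [-> // | j1].
  case: (eqVneq j i0) => [-> | j0]; first by move: mr mr'; rewrite E; lia.
  by transitivity 0%N; [|symmetry]; apply: others => //; rewrite md.
rewrite nth_default ?(eqP h1) // => /esym/eqP.
by rewrite mcoeff_eq0 mf.
Qed.

Section GramCriterion.
Variables (K : closedFieldType) (W : vectType K) (r : nat).

(** The matrix entries become linear forms, so each Leibniz term is homogeneous of degree [r]. *)
Lemma det_linear_mpoly (N : nat) (b : N.-tuple W) (A : {linear W -> 'M[K]_r}) :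
  exists2 f : {mpoly K[N]}, f \is r.-homog &
    forall v, f.@[v] = \det (A (\sum_i v i *: b`_i)).
Proof.
pose M : 'M[{mpoly K[N]}]_r := \matrix_(i, j) \sum_(k < N) A b`_k i j *: 'X_k.
exists (\det M); last first.
  move=> v; rewrite -det_map_mx; congr (\det _); apply/matrixP => i j.
  rewrite !mxE linear_sum summxE raddf_sum /=; apply: eq_bigr => k _.
  by rewrite mevalZ mevalXU linearZ /= mxE mulrC.
have hM i j : M i j \is 1.-homog.
  rewrite mxE; apply: rpred_sum => k _; apply: rpredZ.
  by rewrite dhomogX /= mdeg1.
apply: rpred_sum => s _; rewrite mulr_sign.
set p := \prod_(i < r) _; suff hp : p \is (\sum_(i < r) 1).-homog.
  by move: hp; rewrite sum1_card card_ord => hp; case: ifP => _; rewrite ?rpredN.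
apply: (big_ind2 (fun p d => p \is d.-homog)) => //.
  exact: dhomog1.
by move=> p1 d1 p2 d2; apply: dhomogM.
Qed.

(** In a basis starting with [x, y], the determinant of [A] has a pure power of the first coordinate
    as its only term in these two coordinates alone, and that of [B] contains a pure power of the
    second. *)
Lemma codim2_of_determinants (X : W -> Prop) (A B : {linear W -> 'M[K]_r}) (x y : W) :
  (0 < r)%N -> (forall v, \det (A (x + v *: y)) != 0) -> \det (B y) != 0 ->
  (forall w, X w -> \det (A w) = 0 /\ \det (B w) = 0) ->
  zdim_le X (\dim {:W} - 2).
Proof.
move=> r0 dA dB XAB.
(* The empty determinant is [1], so this needs [0 < r]; it rules out [y = 0] and [x] proportional to
   [y]. *)
have det00 : \det (0 : 'M[K]_r) = 0 by rewrite -(prednK r0) in A B dA dB XAB *; rewrite det0.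
have y0 : y != 0 by apply: contra_neq dB => ->; rewrite linear0.
have xy : free [:: x; y].
  rewrite free_cons span_seq1 free_cons nil_free andbT span_nil memv0 y0 andbT.
  apply/vlineP => -[c xE]; case/eqP: (dA (- c)).
  by rewrite xE scaleNr subrr linear0.
pose s := [:: x; y] ++ vbasis (<<[:: x; y]>>^C)%VS.
have bs : basis_of fullv s.
  rewrite -(addv_complf <<[:: x; y]>>); apply: cat_basis.
  - by apply/directv_addP; exact: capv_compl.
  - by rewrite /basis_of eqxx.
  exact: vbasisP.
have szs : size s = \dim {:W} by rewrite (vector.size_basis (X := in_tuple s) bs).
pose b : (\dim {:W}).-tuple W := Tuple (introT eqP szs).
have N2 : (1 < \dim {:W})%N by rewrite -szs.
pose i0 := Ordinal (ltnW N2); pose i1 := Ordinal N2.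
have i01 : i0 != i1 by [].
have [f hf fE] := det_linear_mpoly b A.
have [g hg gE] := det_linear_mpoly b B.
have pt (v0 v1 : K) : \sum_i (v0 * (i == i0)%:R + v1 * (i == i1)%:R) *: b`_i = v0 *: x + v1 *: y.
  rewrite (bigD1 i0) //= (bigD1 i1) //= big1 => [|j /andP[j0 j1]].
    by rewrite !(mulr0, mulr1, addr0, add0r).
  by rewrite (negPf j0) (negPf j1) !mulr0 addr0 scale0r.
have [f_lead f_supp] : f@_(U_(i0) *+ r) != 0 /\
    (forall m, m \in msupp f ->
      mdeg m = r /\ (m = (U_(i0) *+ r)%MM \/ (m i0 + m i1 < r)%N)).
  apply: lead_coef_homog_line => // v; rewrite fE.
  have := pt 1 v; rewrite scale1r => E; have := dA v; rewrite -E.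
  by congr (\det (A _) != 0); apply: eq_bigr => i _; rewrite mul1r.
have g_lead : g@_(U_(i1) *+ r) != 0.
  apply: lead_coef_homog_point => //; rewrite gE.
  have := pt 0 1; rewrite scale0r scale1r add0r => E; have := dB; rewrite -{1}E.
  by congr (\det (B _) != 0); apply: eq_bigr => i _; rewrite mul0r add0r mul1r.
have wE w : \sum_i coord b i w *: b`_i = w by rewrite -(coord_basis (X := b) bs (memvf w)).
apply: (@codim2_criterion _ _ _ r b i0 i1 f g) => //.
- by move=> w /XAB[]; rewrite fE wE.
- by move=> w /XAB[]; rewrite gE wE.
- by move/dhomogP: hg.
Qed.

End GramCriterion.

(** * Lower bound for the index *)

(** With [E'] a right inverse of [E] and [s = t^-1], the product of [E + s *: F] with [- t *: E'] is
    [G - t%:M], invertible unless [t] is an eigenvalue of [G]. The factor ['X] excludes [t = 0]. *)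
Lemma row_free_pencil (K : closedFieldType) p q (E F : 'M[K]_(p, q)) :
  row_free E -> exists2 s : K, s != 0 & row_free (E + s *: F).
Proof.
case/row_freeP => E' EE'; pose G := - (F *m E').
have : char_poly G * 'X != 0.
  by rewrite mulf_neq0 ?polyX_eq0 // monic_neq0 // char_poly_monic.
case/closed_nonrootP => t; rewrite rootM rootX negb_or => /andP[tG t0].
exists t^-1; first by rewrite invr_eq0.
have : row_free (G - t%:M).
  rewrite -kermx_eq0; move: tG; rewrite -eigenvalue_root_char /eigenvalue negbK.
  by rewrite /eigenspace.
have -> : G - t%:M = (E + t^-1 *: F) *m (- t *: E').
  rewrite -scalemxAr mulmxDl EE' -scalemxAl scalerDr scalerA mulNr mulfV //.
  by rewrite scaleN1r scaleNr scalemx1 addrC.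
case/row_freeP => H HH; apply/row_freeP; exists ((- t *: E') *m H).
by rewrite mulmxA.
Qed.

(** The second rank is that of the map induced by [B] from the kernel of [A] to its cokernel. Rows
    [X *m A] spanning the image of [A], together with rows [Y *m B], [Y] in the kernel, that are
    independent modulo this image, stay independent when [A] is perturbed to [A + s *: B] in the
    first group. *)
Lemma rank_pencil (K : closedFieldType) q (A B : 'M[K]_q) :
  exists s : K, (\rank A + \rank (kermx A *m (B *m cokermx A)) <= \rank (A + s *: B)%R)%N.
Proof.
set C := kermx A *m _.
have /submxP [X XA] : (row_base A <= A)%MS by rewrite eq_row_base submx_refl.
have /submxP [Y' YC] : (row_base C <= C)%MS by rewrite eq_row_base submx_refl.
pose Y := Y' *m kermx A.
have YA : Y *m A = 0 by rewrite -mulmxA mulmx_ker mulmx0.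
have YB : Y *m B *m cokermx A = row_base C by rewrite YC -!(mulmxA Y') -(mulmxA (kermx A)).
have E0 : row_free (col_mx (X *m A) (Y *m B)).
  apply: inj_row_free => v; rewrite -[v]hsubmxK mul_row_col => E.
  have r0 : rsubmx v = 0.
    apply: (row_free_inj (row_base_free C)); rewrite mul0mx.
    have := congr1 (mulmx^~ (cokermx A)) E.
    rewrite mulmxDl -(mulmxA (lsubmx v)) -(mulmxA X) mulmx_coker !mulmx0 add0r.
    by rewrite -(mulmxA (rsubmx v)) YB mul0mx.
  move: E; rewrite r0 mul0mx addr0 -XA => E.
  have -> : lsubmx v = 0 by apply: (row_free_inj (row_base_free A)); rewrite mul0mx.
  by rewrite row_mx0.
have [s s0 Es] := row_free_pencil (col_mx (X *m B) 0) E0.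
exists s; rewrite -(eqP Es); apply: mxrankS.
rewrite scale_col_mx scaler0 add_col_mx addr0 col_mx_sub.
apply/andP; split; first by rewrite scalemxAr -mulmxDr; exact: submxMl.
(* Since [Y *m A = 0], the second group already lies in the row space of the pencil. *)
have -> : Y *m B = (s^-1 *: Y) *m (A + s *: B).
  by rewrite mulmxDr -!scalemxAl YA scaler0 add0r -scalemxAr scalerA mulVf ?scale1r.
exact: submxMl.
Qed.

(** Induction on the size: a row eigenvector is made the first basis vector, which clears the rest
    of the first row. *)
Lemma trigonalizable_closed (K : closedFieldType) n (M : 'M[K]_n) :
  exists2 P : 'M[K]_n, P \in unitmx & is_trig_mx (P *m M *m invmx P).
Proof.
elim: n => [|n IH] in M *.
  by exists 1%:M; rewrite ?unitmx1 //; apply/is_trig_mxP => -[].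
move: M; suff H (M : 'M[K]_(1 + n)) :
  exists2 P : 'M[K]_(1 + n), P \in unitmx & is_trig_mx (P *m M *m invmx P) by exact: H.
have [a /eigenvalueP [v vM v0]] : exists a, eigenvalue M a.
  have : size (char_poly M) != 1%N by rewrite size_char_poly.
  by case/closed_rootP => a; rewrite -eigenvalue_root_char; exists a.
pose R := row_ebase v; have Ru : R \in unitmx := row_ebase_unit v.
pose T : 'M_(1 + n) := R *m M *m invmx R.
have T0 : delta_mx 0 0 *m T = a *: (delta_mx 0 0 : 'rV_(1 + n)).
  have rv : \rank v = 1%N by rewrite rank_rV v0.
  have := mulmx_ebase v; rewrite rv -/R.
  have -> : pid_mx 1 = delta_mx 0 0 :> 'rV[K]_(1 + n).
    by apply/matrixP => i j; rewrite !mxE !ord1 /=; case: j => -[].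
  move=> vE; have c0 : col_ebase v 0 0 != 0.
    by apply: contra v0 => /eqP c0; rewrite -vE [col_ebase v]mx11_scalar c0 raddf0 !mul0mx.
  have dE : delta_mx 0 0 = (col_ebase v 0 0)^-1 *: (v *m invmx R).
    rewrite -{2}vE mulmxK // [X in X *m delta_mx _ _]mx11_scalar mul_scalar_mx.
    by rewrite scalerA mulVf // scale1r.
  by rewrite dE /T -scalemxAl !mulmxA mulmxKV // vM -scalemxAl scalerA mulrC -scalerA.
have [Q Qu Qt] := IH (drsubmx T).
have bu : (block_mx 1%:M 0 0 Q : 'M_(1 + n)) \in unitmx.
  by rewrite unitmxE det_ublock det1 mul1r -unitmxE.
exists (block_mx 1%:M 0 0 Q *m R); first by rewrite unitmx_mul bu.
have -> : block_mx 1%:M 0 0 Q *m R *m M *m invmx (block_mx 1%:M 0 0 Q *m R) =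
   block_mx 1%:M 0 0 Q *m T *m block_mx 1%:M 0 0 (invmx Q).
  have -> : invmx (block_mx 1%:M 0 0 Q *m R) = invmx R *m block_mx 1%:M 0 0 (invmx Q).
    apply: (@row_free_inj _ _ _ _ (block_mx 1%:M 0 0 Q *m R)).
      by rewrite row_free_unit unitmx_mul bu.
    rewrite mulVmx ?unitmx_mul ?bu // -mulmxA (mulmxA (block_mx _ _ _ (invmx Q))).
    by rewrite mulmx_block !(mulmx0, mul0mx, mulmx1, mul1mx, addr0, add0r)
      mulVmx // -scalar_mx_block mul1mx mulVmx.
  by rewrite /T !mulmxA.
have Tur : ursubmx T = 0.
  apply/matrixP => i j; rewrite !mxE !ord1.
  have := congr1 (fun u : 'rV_(1 + n) => u 0 (rshift 1 j)) T0.
  rewrite -rowE !mxE; have -> : lshift n (0 : 'I_1) = 0 by apply: val_inj.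
  by move=> ->; rewrite mulr0.
rewrite -[T]submxK Tur !mulmx_block !(mulmx0, mul0mx, mulmx1, mul1mx, addr0, add0r).
rewrite is_trig_block_mx // eqxx /= Qt andbT.
by apply/is_trig_mxP => i j; rewrite !ord1 ltnn.
Qed.

(** * The bracket on the centraliser and its stabilisers *)

Section LieCentraliser.
Variables (K : fieldType) (n : nat).

Definition lie_right (e x : 'M[K]_n) := lie x e.

Fact lie_right_linear e : linear (lie_right e).
Proof.
move=> a x y; rewrite /lie_right /lie mulmxDl mulmxDr -scalemxAl -scalemxAr.
by rewrite opprD addrACA -scalerBr.
Qed.
HB.instance Definition _ e :=
  GRing.isLinear.Build K 'M[K]_n 'M[K]_n *:%R (lie_right e) (lie_right_linear e).

Lemma lieC (x y : 'M[K]_n) : lie x y = - lie y x.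
Proof. by rewrite /lie opprB. Qed.

Lemma lie_leftD (x y z : 'M[K]_n) a : lie (a *: x + y) z = a *: lie x z + lie y z.
Proof. exact: (linearP (lie_right z)). Qed.

Lemma lie_rightD (x y z : 'M[K]_n) a : lie z (a *: x + y) = a *: lie z x + lie z y.
Proof. by rewrite lieC lie_leftD opprD -scalerN -!lieC. Qed.

Lemma mem_centraliser (e x : 'M[K]_n) : (x \in centraliser e) = (x *m e == e *m x).
Proof.
rewrite memv_ker -[linfun _]/(linfun (lie_right e)) lfunE /=.
by rewrite /lie_right /lie subr_eq0.
Qed.

Lemma lie_centraliser (e x y : 'M[K]_n) :
  x \in centraliser e -> y \in centraliser e -> lie x y \in centraliser e.
Proof.
rewrite !mem_centraliser => /eqP xe /eqP ye; apply/eqP.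
rewrite /lie mulmxBl mulmxBr -!mulmxA ye xe (mulmxA x) xe (mulmxA y) ye.
by rewrite !mulmxA.
Qed.

End LieCentraliser.

Section Form.
Variables (K : fieldType) (n : nat) (e : 'M[K]_n).
Notation ge := (subvs_of (centraliser e)).

Definition bracket (x y : ge) : ge := vsproj (centraliser e) (lie (vsval x) (vsval y)).

Lemma vsval_bracket x y : vsval (bracket x y) = lie (vsval x) (vsval y).
Proof. by rewrite vsprojK // lie_centraliser // subvsP. Qed.

Fact bracket_linear x : linear (bracket x).
Proof.
by move=> a y z; apply: val_inj; rewrite /= !(vsval_bracket, linearP) /= lie_rightD.
Qed.
HB.instance Definition _ x :=
  GRing.isLinear.Build K ge ge *:%R (bracket x) (bracket_linear x).

Lemma bracketC x y : bracket x y = - bracket y x.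
Proof. by apply: val_inj; rewrite /= !vsval_bracket lieC. Qed.

Lemma bracket_leftD a x y z : bracket (a *: x + y) z = a *: bracket x z + bracket y z.
Proof.
by apply: val_inj; rewrite /= !(vsval_bracket, linearP) /= lie_leftD.
Qed.

(** [linfun] is known to compute its argument only for linear maps, so both nested maps are first
    equipped with linear structures. *)
Lemma mem_stab (gamma : dual_ge e) x :
  x \in stab gamma <-> forall y, gamma (bracket x y) = 0.
Proof.
pose h x : ge -> K^o := gamma \o bracket x.
have h_lin z : linear (h z) by move=> a y t; rewrite /h /= !linearP.
pose H z : {linear ge -> K^o} := HB.pack (h z) (GRing.isLinear.Build _ _ _ _ (h z) (h_lin z)).
pose G z : 'Hom(ge, K^o) := linfun (h z).
have GE z y : G z y = gamma (bracket z y) by rewrite /G -[linfun (h z)]/(linfun (H z)) lfunE.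
have G_lin : linear G.
  move=> a y z; apply/lfunP => t; rewrite !(lfunE, GE) /= GE.
  by rewrite scale_lfunE GE bracket_leftD linearP.
pose GL : {linear ge -> 'Hom(ge, K^o)} := HB.pack G (GRing.isLinear.Build _ _ _ _ G G_lin).
have -> : stab gamma = lker (linfun GL) by [].
rewrite memv_ker lfunE /=; split.
  by move=> /eqP Gx y; rewrite -GE /= [G x]Gx zero_lfunE.
by move=> H0; apply/eqP/lfunP => y; rewrite zero_lfunE [LHS]GE.
Qed.

End Form.

Lemma dim_subspace_of_free (K : fieldType) (W : vectType K) k (F : 'I_k -> W) (V : {vspace W}) :
  (forall i, F i \in V) -> (forall c : 'I_k -> K, \sum_i c i *: F i = 0 -> forall i, c i = 0) ->
  (k <= \dim V)%N.
Proof.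
move=> FV Ffree; pose s := [tuple F i | i < k].
have /eqP <- : \dim <<s>> == k.
  rewrite -[X in _ == X](size_tuple s) -/(free s); apply/freeP => c sc.
  by apply: Ffree; rewrite -[RHS]sc; apply: eq_bigr => i _; rewrite (nth_map i) ?size_enum_ord // nth_ord_enum.
by apply/dimvS/span_subvP => _ /mapP[i _ ->].
Qed.

(** * Dimension of centralisers in the full matrix algebra *)

Section Triangular.
Variables (K : fieldType) (n : nat).
Implicit Types x y : 'M[K]_n.

Lemma mulmx_trig_entry x y (i j : 'I_n) : is_trig_mx x -> is_trig_mx y -> (i <= j)%N ->
  (x *m y) i j = if i == j then x i i * y i i else 0.
Proof.
move=> /is_trig_mxP xt /is_trig_mxP yt ij; rewrite mxE (bigD1 i) //= big1 => [|k ki].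
  case: eqP => [<- | /eqP ne]; rewrite addr0 // yt ?mulr0 //.
  by rewrite ltn_neqAle ij andbT.
have [lt | le] := ltnP i k; first by rewrite xt ?mul0r.
rewrite yt ?mulr0 //; apply: leq_trans ij.
by rewrite ltn_neqAle le andbT.
Qed.

Definition strict_upper x : 'M[K]_n := \matrix_(i, j) if (i < j)%N then x i j else 0.
Fact strict_upper_linear : linear strict_upper.
Proof. by move=> a x y; apply/matrixP => i j; rewrite !mxE; case: ltnP; rewrite ?mulr0 ?addr0. Qed.
HB.instance Definition _ :=
  GRing.isLinear.Build K 'M[K]_n 'M[K]_n *:%R strict_upper strict_upper_linear.

Definition diag_entries x : 'rV[K]_n := \row_i x i i.
Fact diag_entries_linear : linear diag_entries.
Proof. by move=> a x y; apply/rowP => i; rewrite !mxE. Qed.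
HB.instance Definition _ :=
  GRing.isLinear.Build K 'M[K]_n 'rV[K]_n *:%R diag_entries diag_entries_linear.

Lemma mem_ker_strict_upper x : (x \in lker (linfun strict_upper)) = is_trig_mx x.
Proof.
rewrite memv_ker lfunE /=; apply/eqP/is_trig_mxP => [/matrixP x0 i j ij | xt].
  by have := x0 i j; rewrite !mxE ij.
by apply/matrixP => i j; rewrite !mxE; case: ltnP => // /xt.
Qed.

(* A triangular matrix normalises the triangular matrices and maps them to strictly triangular ones. *)
Lemma dim_centraliser_trig x : is_trig_mx x -> (n <= \dim (centraliser x))%N.
Proof.
move=> xt; pose U := lker (linfun strict_upper); pose d := linfun diag_entries.
pose f := linfun (lie_right x).
have dU : (d @: U)%VS = fullv.
  apply/eqP; rewrite eqEsubv subvf /=; apply/subvP => v _.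
  apply/memv_imgP; exists (diag_mx v); last first.
    by rewrite lfunE; apply/rowP => i; rewrite !mxE eqxx.
  rewrite mem_ker_strict_upper; apply/is_trig_mxP => i j ij.
  by rewrite !mxE -val_eqE /= ltn_eqF.
have fU : (f @: U <= U :&: lker d)%VS.
  apply/subvP => _ /memv_imgP[y yU ->]; rewrite lfunE memv_cap.
  rewrite !mem_ker_strict_upper in yU *; rewrite memv_ker lfunE /= /lie_right /lie.
  apply/andP; split.
    apply/is_trig_mxP => i j ij; have ij' := ltnW ij; rewrite mxE [X in _ + X]mxE.
    by have := mulmx_trig_entry yU xt ij'; have := mulmx_trig_entry xt yU ij';
      rewrite -val_eqE /= ltn_eqF // => -> ->; rewrite subrr.
  apply/eqP/rowP => i.
  have := mulmx_trig_entry yU xt (leqnn i); have := mulmx_trig_entry xt yU (leqnn i).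
  by rewrite eqxx => Exy Eyx; rewrite [LHS]mxE [RHS]mxE [LHS]mxE [X in _ + X]mxE Exy Eyx; rewrite mulrC subrr.
(* Rank-nullity twice: [f] maps [U] into the kernel of [d] on [U], of dimension [\dim U - n], so the
   kernel of [f] on [U] has dimension at least [n]. *)
have E1 := limg_ker_dim d U; have E2 := limg_ker_dim f U.
have le1 := dimvS fU; have le2 := dimvS (capvSr U (lker f)).
have dn : \dim {: 'rV[K]_n} = n by rewrite dimvf /dim /= mul1n.
rewrite dU dn in E1; rewrite -[centraliser x]/(lker f).
by apply: leq_trans le2; rewrite -(leq_add2r (\dim (f @: U))) E2 -E1 addnC leq_add2r.
Qed.

End Triangular.

(** Conjugation maps the centraliser of a triangular form injectively into that of [x]. *)
Lemma dim_centraliser_ge (K : closedFieldType) n (x : 'M[K]_n) :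
  (n <= \dim (centraliser x))%N.
Proof.
have [P Pu Pt] := trigonalizable_closed x; set t := P *m x *m invmx P in Pt.
apply: leq_trans (dim_centraliser_trig Pt) _.
have xE : x = invmx P *m t *m P by rewrite /t -!mulmxA mulKmx // mulVmx // mulmx1.
clearbody t; pose c y := invmx P *m y *m P.
have c_lin : linear c.
  by move=> a y z; rewrite /c mulmxDr mulmxDl -scalemxAr -scalemxAl.
pose C : {linear 'M[K]_n -> 'M[K]_n} :=
  HB.pack c (GRing.isLinear.Build _ _ _ _ c c_lin).
have CK : lker (linfun C) = 0%VS.
  apply/eqP/lker0P => y z; rewrite !lfunE /= /c => /(congr1 (fun u => P *m u *m invmx P)).
  by rewrite -!mulmxA !(mulKVmx Pu, mulmxV Pu, mulmx1).
have := limg_ker_dim (linfun C) (centraliser t); rewrite CK capv0 dimv0 add0n => <-.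
apply: dimvS; apply/subvP => _ /memv_imgP[y yt ->].
rewrite lfunE /=; move: yt; rewrite !mem_centraliser => /eqP yt; apply/eqP.
rewrite /c xE.
by rewrite -!mulmxA !(mulKVmx Pu) (mulmxA y) yt !mulmxA.
Qed.

(** * Vinberg's inequality *)

Section Vinberg.
Variables (K : closedFieldType) (n : nat) (e : 'M[K]_n).

Definition ad_mx (x : 'M[K]_n) : 'M[K]_(n * n) := lin_mx (lie_right x).

Lemma rank_ad_mx x : (\rank (ad_mx x) + n <= n * n)%N.
Proof.
have : (n <= \rank (kermx (ad_mx x)))%N.
  apply: leq_trans (dim_centraliser_ge x) _.
  pose b := vbasis (centraliser x).
  pose M := \matrix_i mxvec b`_i : 'M[K]_(\dim (centraliser x), n * n).
  have Mfree : row_free M.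
    apply: inj_row_free => v vM; apply/rowP => i; rewrite mxE.
    have /freeP := basis_free (vbasisP (centraliser x)); apply.
    apply: (can_inj mxvecK); rewrite linear_sum linear0 -[RHS]vM mulmx_sum_row.
    by apply: eq_bigr => j _; rewrite linearZ rowK.
  rewrite -{1}(eqP Mfree); apply: mxrankS; apply/sub_kermxP/row_matrixP => i.
  rewrite row_mul rowK row0 mul_vec_lin.
  have : b`_i \in centraliser x by apply: vbasis_mem; rewrite mem_nth ?size_tuple.
  by rewrite mem_centraliser -subr_eq0 => /eqP bx; rewrite /= /lie_right /lie bx linear0.
by rewrite mxrank_ker; have := rank_leq_row (ad_mx x); lia.
Qed.

Lemma ad_mx_pencil x y s : ad_mx (x + s *: y) = ad_mx x + s *: ad_mx y.
Proof.
apply/row_matrixP => i; rewrite !rowE mulmxDr -scalemxAr.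
rewrite -[delta_mx 0 i]vec_mxK !mul_vec_lin -linearZ -linearD /=; congr mxvec.
by rewrite /lie_right [x + _]addrC lie_rightD addrC.
Qed.

(** [vsproj] extends [gamma] to all matrices, and its values on elementary matrices are the entries
    of [f]. *)
Lemma dual_trace_form (gamma : dual_ge e) :
  exists f, forall x, \tr (f *m x) = gamma (vsproj (centraliser e) x).
Proof.
exists (\matrix_(i, j) gamma (vsproj (centraliser e) (delta_mx j i))) => x.
rewrite [in RHS](matrix_sum_delta x) !linear_sum /mxtrace /=.
under eq_bigr do rewrite mxE.
rewrite exchange_big; apply: eq_bigr => i _; rewrite !linear_sum /=.
by apply: eq_bigr => j _; rewrite !linearZ mxE mulrC.
Qed.

(* Vinberg's inequality [ind g_e >= ind g]: write [gamma = tr(f -)]. Every centraliser of [e + s f]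
   has dimension at least [n], and for a suitable [s] it is no larger than the space of the [x] in
   [ker (ad e)] with [[x, f]] in [im (ad e)], which lies in the stabiliser of [gamma]. *)
Lemma dim_stab_ge (gamma : dual_ge e) : (n <= \dim (stab gamma))%N.
Proof.
have [f fE] := dual_trace_form gamma.
have [s] := rank_pencil (ad_mx e) (ad_mx f); rewrite -ad_mx_pencil => le.
set C := ad_mx f *m cokermx (ad_mx e) in le.
pose S := (kermx (ad_mx e) :&: kermx C)%MS.
have nS : (n <= \rank S)%N.
  have := mxrank_mul_ker (kermx (ad_mx e)) C; rewrite -/S mxrank_ker => E.
  have := rank_ad_mx (e + s *: f); have := rank_leq_row (ad_mx e).
  move: E le; set a := \rank (ad_mx e); set b := \rank (_ *m C); set k := \rank _.
  by set l := \rank _; lia.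
apply: leq_trans nS _.
pose F i := vsproj (centraliser e) (vec_mx (row i (row_base S))).
have rS i : (row i (row_base S) <= S)%MS.
  by rewrite (submx_trans (row_sub i _)) // eq_row_base submx_refl.
have rC i : vec_mx (row i (row_base S)) \in centraliser e.
  have := rS i; rewrite sub_capmx => /andP[/sub_kermxP E _].
  move: E; rewrite -[row i _]vec_mxK mul_vec_lin mxvecK -(linear0 mxvec).
  by move=> /(can_inj mxvecK)/eqP; rewrite mem_centraliser /lie_right /lie subr_eq0.
apply: (@dim_subspace_of_free _ _ _ F) => [i | c Fc].
  apply/mem_stab => y; rewrite /bracket -fE vsprojK //.
  have := rS i; rewrite sub_capmx => /andP[_ /sub_kermxP].
  have := rC i; set x := vec_mx _; rewrite -[row i _]vec_mxK -/x => xe.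
  rewrite mulmxA mul_vec_lin => /eqP.
  rewrite -submxE => /submxP[z]; rewrite -[z]vec_mxK mul_vec_lin.
  move=> /(can_inj mxvecK); move: (vec_mx z) (vsval y) (subvsP y) => {}z {}y.
  rewrite mem_centraliser => /eqP ye; rewrite /= /lie_right => xf.
  (* Invariance of the trace. Afterwards [[x, f] = [z, e]], and [\tr ([z, e] y)] vanishes because
     [y] commutes with [e]. *)
  have -> : \tr (f *m lie x y) = - \tr (lie x f *m y).
    have trB (p q : 'M[K]_n) : \tr (p - q) = \tr p - \tr q by rewrite raddfB.
    rewrite /lie mulmxBr mulmxBl !trB opprB mulmxA; congr (_ - _).
    by rewrite mulmxA mxtrace_mulC mulmxA.
  rewrite xf /lie mulmxBl raddfB /= -(mulmxA e) [\tr (e *m _)]mxtrace_mulC.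
  by rewrite -!mulmxA ye subrr oppr0.
have : (\row_i c i) *m row_base S = 0.
  rewrite mulmx_sum_row; apply: (can_inj vec_mxK); rewrite linear_sum linear0 /=.
  have := congr1 vsval Fc; rewrite linear_sum linear0 /= => E; rewrite -[RHS]E.
  by apply: eq_bigr => i _; rewrite !linearZ /= vsprojK // mxE.
move=> /eqP; rewrite -(mul0mx _ (row_base S)) => /eqP/(row_free_inj (row_base_free S)).
by move/rowP => c0 i; have := c0 i; rewrite !mxE.
Qed.

End Vinberg.

(** * Jordan chains of a nilpotent matrix *)

Section JordanSystem.
Variables (K : fieldType) (n : nat) (e : 'M[K]_n).

Lemma exprmxD a b : e ^+ (a + b) = e ^+ a *m e ^+ b. Proof. exact: exprD. Qed.
Lemma exprmxS a : e ^+ a.+1 = e *m e ^+ a. Proof. exact: exprS. Qed.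
Lemma exprmxSr a : e ^+ a.+1 = e ^+ a *m e. Proof. exact: exprSr. Qed.

(** The commutator of this sum with [e] telescopes to [psi v e^(d+1) - e^(d+1) psi v]. *)
Definition chain_mx d (psi : 'cV[K]_n) (v : 'rV[K]_n) : 'M[K]_n :=
  \sum_(a < d.+1) e ^+ a *m psi *m (v *m e ^+ (d - a)).

Lemma chain_mx_comm d psi v : e ^+ d.+1 *m psi = 0 -> v *m e ^+ d.+1 = 0 ->
  chain_mx d psi v *m e = e *m chain_mx d psi v.
Proof.
move=> psi0 v0; rewrite /chain_mx mulmx_suml mulmx_sumr big_ord_recl [RHS]big_ord_recr /=.
rewrite subn0 -(mulmxA _ _ e) -(mulmxA v) -exprmxSr v0 mulmx0 add0r.
rewrite !(mulmxA e) -exprmxS psi0 mul0mx addr0; apply: eq_bigr => a _.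
rewrite /bump /= add1n -!(mulmxA _ _ e) -exprmxSr !(mulmxA e) -exprmxS.
by rewrite -subSn // subSS.
Qed.

(* The vectors [v i *m e ^+ s], [s < lam i], form the Jordan chains and the [e ^+ s *m psi i] the dual chains. *)
Record jordan_system m (lam : nat -> nat) (v : nat -> 'rV[K]_n) (psi : nat -> 'cV[K]_n) := {
  js_pair : forall i j s, (i < m)%N -> (j < m)%N ->
    v i *m e ^+ s *m psi j = ((i == j) && (s.+1 == lam i))%:R%:M;
  js_row : forall i, (i < m)%N -> v i *m e ^+ lam i = 0;
  js_col : forall i, (i < m)%N -> e ^+ lam i *m psi i = 0;
  js_pos : forall i, (i < m)%N -> (0 < lam i)%N;
  js_dec : forall i j, (i <= j)%N -> (j < m)%N -> (lam j <= lam i)%N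
}.

(** By the pairing of rows and columns, this is the projection onto the [i]-th Jordan block
    commuting with [e]. *)
Definition block_proj (lam : nat -> nat) (v : nat -> 'rV[K]_n) (psi : nat -> 'cV[K]_n) i :=
  chain_mx (lam i).-1 (psi i) (v i).
Definition rest_proj m lam v psi : 'M[K]_n := 1%:M - \sum_(i < m) block_proj lam v psi i.

Section Theory.
Variables (m : nat) (lam : nat -> nat) (v : nat -> 'rV[K]_n) (psi : nat -> 'cV[K]_n).
Hypothesis J : jordan_system m lam v psi.

Lemma row_nilp i s : (i < m)%N -> (lam i <= s)%N -> v i *m e ^+ s = 0.
Proof. by move=> im le; rewrite -(subnKC le) exprmxD mulmxA (js_row J) // mul0mx. Qed.

Lemma col_nilp i s : (i < m)%N -> (lam i <= s)%N -> e ^+ s *m psi i = 0.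
Proof. by move=> im le; rewrite -(subnK le) exprmxD -mulmxA (js_col J) // mulmx0. Qed.

(** Only the term [a = lam k - s.+1] survives the pairing. If [lam k <= s] there is none, and the
    right side vanishes because its exponent exceeds [d]. *)
Lemma row_chain_mx i k w s d : (i < m)%N -> (k < m)%N -> (lam k <= d.+1)%N ->
  w *m e ^+ d.+1 = 0 ->
  v i *m e ^+ s *m chain_mx d (psi k) w = (i == k)%:R *: (w *m e ^+ (d + s.+1 - lam k)).
Proof.
move=> im km le w0; have w0' t : (d < t)%N -> w *m e ^+ t = 0.
  by move=> dt; rewrite -(subnKC dt) exprmxD mulmxA w0 mul0mx.
have E (a : 'I_d.+1) : v i *m e ^+ s *m (e ^+ a *m psi k *m (w *m e ^+ (d - a))) =
    ((i == k) && ((s + a).+1 == lam i))%:R *: (w *m e ^+ (d - a)).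
  by rewrite !mulmxA -(mulmxA (v i)) -exprmxD (js_pair J) // mul_scalar_mx -scalemxAl.
rewrite mulmx_sumr (eq_bigr _ (fun a _ => E a)).
case: (eqVneq i k) => [-> | _] /=; last by rewrite scale0r big1 // => a _; rewrite scale0r.
rewrite scale1r; have [lt | ge] := ltnP s (lam k); last first.
  rewrite w0' => [|]; last by lia.
  by rewrite big1 // => a _; case: eqP; rewrite ?scale0r //; lia.
have ad : (lam k - s.+1 < d.+1)%N by lia.
rewrite (bigD1 (Ordinal ad)) //= big1 => [|a ne].
  have -> : ((s + (lam k - s.+1)).+1 == lam k) by apply/eqP; lia.
  by rewrite scale1r addr0; congr (_ *m e ^+ _); lia.
case: eqP => [E' | _]; last by rewrite scale0r.
by case/eqP: ne; apply: val_inj => /=; lia.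
Qed.

Lemma chain_mx_col i k w s d : (i < m)%N -> (k < m)%N -> (lam k <= d.+1)%N ->
  e ^+ d.+1 *m w = 0 ->
  chain_mx d w (v k) *m (e ^+ s *m psi i) = (i == k)%:R *: (e ^+ (d + s.+1 - lam k) *m w).
Proof.
move=> im km le w0; have w0' t : (d < t)%N -> e ^+ t *m w = 0.
  by move=> dt; rewrite -(subnK dt) exprmxD -mulmxA w0 mulmx0.
have E (a : 'I_d.+1) : e ^+ a *m w *m (v k *m e ^+ (d - a)) *m (e ^+ s *m psi i) =
    ((i == k) && ((d - a + s).+1 == lam k))%:R *: (e ^+ a *m w).
  rewrite -!mulmxA (mulmxA (e ^+ (d - a))) -exprmxD (mulmxA (v k)) (js_pair J) //.
  by rewrite mul_mx_scalar -scalemxAr eq_sym.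
rewrite mulmx_suml (eq_bigr _ (fun a _ => E a)).
case: (eqVneq i k) => [_ | _] /=; last by rewrite scale0r big1 // => a _; rewrite scale0r.
rewrite scale1r; have [lt | ge] := ltnP s (lam k); last first.
  rewrite w0' => [|]; last by lia.
  by rewrite big1 // => a _; case: eqP; rewrite ?scale0r //; lia.
have ad : (d + s.+1 - lam k < d.+1)%N by lia.
rewrite (bigD1 (Ordinal ad)) //= big1 => [|a ne].
  have -> : ((d - (d + s.+1 - lam k) + s).+1 == lam k) by apply/eqP; lia.
  by rewrite scale1r addr0.
case: eqP => [E' | _]; last by rewrite scale0r.
by case/eqP: ne; apply: val_inj => /=; have := ltn_ord a; lia.
Qed.

Lemma row_block_proj i k s : (i < m)%N -> (k < m)%N ->
  v i *m e ^+ s *m block_proj lam v psi k = (i == k)%:R *: (v k *m e ^+ s).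
Proof.
move=> im km; have pos := js_pos J km.
rewrite row_chain_mx // ?prednK ?(js_row J) //.
by congr (_ *: (_ *m e ^+ _)); lia.
Qed.

Lemma block_proj_col i k s : (i < m)%N -> (k < m)%N ->
  block_proj lam v psi k *m (e ^+ s *m psi i) = (i == k)%:R *: (e ^+ s *m psi k).
Proof.
move=> im km; have pos := js_pos J km.
rewrite chain_mx_col // ?prednK ?(js_col J) //.
by congr (_ *: (e ^+ _ *m _)); lia.
Qed.

Lemma block_proj_comm k : (k < m)%N ->
  block_proj lam v psi k *m e = e *m block_proj lam v psi k.
Proof.
by move=> km; apply: chain_mx_comm; rewrite prednK ?(js_pos J) ?(js_col J) ?(js_row J).
Qed.

Notation P := (rest_proj m lam v psi).

Lemma row_rest_proj i s : (i < m)%N -> v i *m e ^+ s *m P = 0.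
Proof.
move=> im; rewrite mulmxBr mulmx1 mulmx_sumr (bigD1 (Ordinal im)) //=.
rewrite row_block_proj // eqxx scale1r big1 ?addr0 ?subrr // => k ne.
rewrite row_block_proj //; have -> : (i == k) = false by apply/negbTE; rewrite eq_sym.
by rewrite scale0r.
Qed.

Lemma rest_proj_col i s : (i < m)%N -> P *m (e ^+ s *m psi i) = 0.
Proof.
move=> im; rewrite mulmxBl mul1mx mulmx_suml (bigD1 (Ordinal im)) //=.
rewrite block_proj_col // eqxx scale1r big1 ?addr0 ?subrr // => k ne.
rewrite block_proj_col //; have -> : (i == k) = false by apply/negbTE; rewrite eq_sym.
by rewrite scale0r.
Qed.

Lemma rest_proj_comm s : P *m e ^+ s = e ^+ s *m P.
Proof.
elim: s => [|s IH]; first by rewrite mulmx1 mul1mx.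
rewrite exprmxS mulmxA; have -> : P *m e = e *m P.
  rewrite mulmxBl mulmxBr mulmx1 mul1mx mulmx_suml mulmx_sumr; congr (_ - _).
  by apply: eq_bigr => k _; apply: block_proj_comm.
by rewrite -!mulmxA IH.
Qed.

Lemma rest_proj_idem : P *m P = P.
Proof.
rewrite {1}/rest_proj mulmxBl mul1mx mulmx_suml big1 ?subr0 // => k _.
rewrite /block_proj /chain_mx mulmx_suml big1 // => a _.
by rewrite -[LHS]mulmxA row_rest_proj // mulmx0.
Qed.

End Theory.

Lemma rest_projS m lam v psi : rest_proj m.+1 lam v psi =
  rest_proj m lam v psi - block_proj lam v psi m.
Proof. by rewrite /rest_proj big_ord_recr opprD addrA. Qed.

(** Scaling makes the pairing with [w e^(N-1)] equal to [1]; subtracting multiples of [e^k psi] then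
    removes the pairings with lower powers one by one. [S] records a property kept by these
    moves. *)
Lemma normalize_col N (w : 'rV[K]_n) (S : 'cV[K]_n -> Prop) (psi0 : 'cV[K]_n) :
  (forall c k psi, S psi -> S (psi + c *: (e ^+ k *m psi))) -> (forall c psi, S psi -> S (c *: psi)) ->
  S psi0 -> (0 < N)%N -> w *m e ^+ N = 0 -> w *m e ^+ N.-1 *m psi0 != 0 ->
  exists2 psi, S psi & forall s, w *m e ^+ s *m psi = (s.+1 == N)%:R%:M.
Proof.
move=> SD SZ S0 N0 wN w0.
have wN' s : (N <= s)%N -> w *m e ^+ s = 0.
  by move=> Ns; rewrite -(subnKC Ns) exprmxD mulmxA wN mul0mx.
suff [psi Spsi psiE] : exists2 psi, S psi &
    forall s, (N - N <= s)%N -> w *m e ^+ s *m psi = (s.+1 == N)%:R%:M.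
  by exists psi => // s; apply: psiE; rewrite subnn.
(* [k] counts the exponents, from [N.-1] downwards, at which the pairing is already correct. *)
have : (0 < N)%N by []; move: {1 3}N => k; elim: k => // k IH _ .
case: k IH => [_ | k IH].
  set c := (w *m e ^+ N.-1 *m psi0) 0 0.
  have cE : w *m e ^+ N.-1 *m psi0 = c%:M by rewrite [LHS]mx11_scalar.
  have c0 : c != 0 by apply: contra w0; rewrite cE => /eqP ->; rewrite raddf0.
  exists (c^-1 *: psi0); first exact: SZ.
  move=> s; rewrite leq_eqVlt => /orP[/eqP <- | lt].
    by rewrite subn1 prednK // eqxx -scalemxAr cE scale_scalar_mx mulVf.
  rewrite wN' ?mul0mx; last by lia.
  by case: eqP => [|_]; [lia | rewrite raddf0].
have [//|psi Spsi psiE] := IH.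
have [le | gt] := leqP N k.+1.
  by exists psi => // s; rewrite (_ : (N - k.+2 = N - k.+1)%N); [apply: psiE | lia].
set c := (w *m e ^+ (N - k.+2) *m psi) 0 0.
have cE : w *m e ^+ (N - k.+2) *m psi = c%:M by rewrite [LHS]mx11_scalar.
exists (psi + (- c) *: (e ^+ k.+1 *m psi)); first exact: SD.
move=> s; rewrite mulmxDr -scalemxAr mulmxA -(mulmxA w _ (e ^+ k.+1)) -exprmxD.
rewrite leq_eqVlt => /orP[/eqP <- | lt].
  rewrite cE psiE; last by lia.
  have -> : ((N - k.+2 + k.+1).+1 == N) by apply/eqP; lia.
  have -> : ((N - k.+2).+1 == N) = false by apply/eqP; lia.
  by rewrite scaleNr scale_scalar_mx mulr1 subrr raddf0.
rewrite psiE; last by lia.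
by rewrite wN' ?mul0mx ?scaler0 ?addr0 //; lia.
Qed.

(** A nonzero entry of [P e^(N-1)], [N] being the nilpotency order of [e] on the image of [P],
    yields a row [w] of [P] whose chain has maximal length there, and a dual column fixed by [P]. *)
Lemma jordan_system_extend m lam v psi (P := rest_proj m lam v psi) :
  (exists k, e ^+ k = 0) ->
  jordan_system m lam v psi -> (forall i, (i < m)%N -> P *m e ^+ lam i = 0) -> P != 0 ->
  exists lam' v' psi' (P' := rest_proj m.+1 lam' v' psi'),
    [/\ jordan_system m.+1 lam' v' psi',
       forall i, (i < m.+1)%N -> P' *m e ^+ lam' i = 0 & (\rank P' < \rank P)%N].
Proof.
move=> [k0 ek0] J Plam P0.
have exN : exists N, P *m e ^+ N == 0 by exists k0; rewrite ek0 mulmx0.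
case: (ex_minnP exN) => N /eqP PN minN.
have N0 : (0 < N)%N.
  by rewrite lt0n; apply: contraNneq P0 => N0; move: PN; rewrite N0 mulmx1 => ->.
have PN1 : P *m e ^+ N.-1 != 0.
  by apply/negP => /minN; rewrite leqNgt ltn_predL N0.
have [a [b Pab]] : exists a b, (P *m e ^+ N.-1) a b != 0.
  apply: NNPP => H; case/eqP: PN1; apply/matrixP => a b; rewrite [RHS]mxE.
  by apply/eqP; rewrite -[_ == _]negbK; apply/negP => ne; apply: H; exists a, b.
pose w := row a P.
have wP s : w *m e ^+ s *m P = w *m e ^+ s.
  by rewrite -mulmxA -(rest_proj_comm J) mulmxA /w -row_mul (rest_proj_idem J).
have wN : w *m e ^+ N = 0 by rewrite -row_mul PN row0.
pose S (q : 'cV[K]_n) := P *m q = q.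
have [psi' Spsi psiE] : exists2 psi', S psi' &
    forall s, w *m e ^+ s *m psi' = (s.+1 == N)%:R%:M.
  apply: (@normalize_col _ _ S (P *m delta_mx b 0)) => //.
  - move=> c k q Sq; rewrite /S mulmxDr Sq -scalemxAr mulmxA (rest_proj_comm J).
    by rewrite -mulmxA Sq.
  - by move=> c q Sq; rewrite /S -scalemxAr Sq.
  - by rewrite /S mulmxA (rest_proj_idem J).
  rewrite mulmxA wP -colE; apply/negP => /eqP /matrixP /(_ 0 0); rewrite !mxE => E.
  by case/eqP: Pab; rewrite -[RHS]E mxE; apply: eq_bigr => j _; rewrite !mxE.
pose lam1 i := if (i < m)%N then lam i else N.
pose v1 i := if (i < m)%N then v i else w.
pose psi1 i := if (i < m)%N then psi i else psi'.
have restE : rest_proj m.+1 lam1 v1 psi1 = P - chain_mx N.-1 psi' w.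
  rewrite rest_projS /block_proj /lam1 /v1 /psi1 ltnn; congr (_ - _).
  rewrite /P /rest_proj; congr (_ - _); apply: eq_bigr => i _.
  by rewrite /block_proj ltn_ord.
have J1 : jordan_system m.+1 lam1 v1 psi1.
  split.
  - move=> i j s; rewrite !ltnS /v1 /psi1 /lam1 => im jm.
    have [li | gi] := ltnP i m; have [lj | gj] := ltnP j m.
    + exact: js_pair J _ _ _ li lj.
    + have -> : (i == j) = false by lia.
      by rewrite /= raddf0 -Spsi mulmxA (row_rest_proj J) // mul0mx.
    + have -> : (i == j) = false by lia.
      have := rest_proj_col J 0 lj; rewrite mul1mx => Pj.
      by rewrite /= raddf0 -wP -mulmxA Pj mulmx0.
    by have -> : (i == j) by lia.
  - move=> i _; rewrite /v1 /lam1; case: (ltnP i m) => [im | _] //; exact: js_row J _ im.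
  - move=> i _; rewrite /psi1 /lam1; case: (ltnP i m) => [im | _]; first exact: js_col J _ im.
    by rewrite -Spsi mulmxA -(rest_proj_comm J) PN mul0mx.
  - by move=> i _; rewrite /lam1; case: (ltnP i m) => [im | _] //; exact: js_pos J _ im.
  move=> i j ij; rewrite ltnS /lam1 => jm; case: (ltnP j m) => [lj | _].
    by rewrite (leq_ltn_trans ij lj); exact: js_dec J _ _ ij lj.
  (* The earlier lengths already kill [P], so minimality of [N] keeps the lengths nonincreasing. *)
  by case: (ltnP i m) => // im; apply: minN; apply/eqP/Plam.
have subP : (rest_proj m.+1 lam1 v1 psi1 <= P)%MS.
  apply/submxP; exists (1%:M - chain_mx N.-1 psi' w).
  rewrite restE mulmxBl mul1mx; congr (_ - _); rewrite /chain_mx mulmx_suml.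
  by apply: eq_bigr => i _; rewrite -!mulmxA (mulmxA w) wP.
exists lam1, v1, psi1; split => //.
  move=> i im; have /submxP[X ->] := subP; rewrite -mulmxA.
  rewrite /lam1; case: (ltnP i m) => [lt | _]; rewrite ?Plam ?PN ?mulmx0 //.
(* The row [w] lies in the image of [P] but is killed by the new idempotent; in the image of the
   latter it would be zero. *)
apply: rank_ltmx; rewrite ltmxE subP /=; apply/negP => PsubP'.
have : (w <= rest_proj m.+1 lam1 v1 psi1)%MS by apply: submx_trans PsubP'; apply: row_sub.
case/submxP => X wX; have := row_rest_proj J1 0 (ltnSn m).
rewrite mulmx1 /v1 ltnn {1}wX -mulmxA (rest_proj_idem J1) -wX => w0.
by case/eqP: Pab; move/rowP: (congr1 (mulmx^~ (e ^+ N.-1)) w0) => /(_ b);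
  rewrite /w -row_mul mul0mx !mxE.
Qed.

Lemma jordan_system_exists : (exists k, e ^+ k = 0) ->
  exists m lam v psi, jordan_system m lam v psi /\ rest_proj m lam v psi = 0.
Proof.
move=> nil.
suff H k m lam v psi : (\rank (rest_proj m lam v psi) < k)%N ->
    jordan_system m lam v psi ->
    (forall i, (i < m)%N -> rest_proj m lam v psi *m e ^+ lam i = 0) ->
    exists m lam v psi, jordan_system m lam v psi /\ rest_proj m lam v psi = 0.
  by apply: (H _ 0%N (fun=> 0%N) (fun=> 0) (fun=> 0) (ltnSn _)).
elim: k => // k IH in m lam v psi *; rewrite ltnS => rk J Pl.
have [P0 | P0] := eqVneq (rest_proj m lam v psi) 0; first by exists m, lam, v, psi.
have [lam' [v' [psi' [J' Pl' lt]]]] := jordan_system_extend nil J Pl P0.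
by apply: (IH m.+1 lam' v' psi') => //; apply: leq_trans rk.
Qed.

End JordanSystem.

(** * A regular plane in the dual of the centraliser *)

Lemma distinct_nonzero (K : closedFieldType) m :
  exists a : nat -> K, (forall i, (i < m)%N -> a i != 0) /\
    (forall i j, (i < m)%N -> (j < m)%N -> a i = a j -> i = j).
Proof.
have [s [us s0 ss]] : exists s : seq K, [/\ uniq s, 0 \notin s & size s = m].
  elim: m => [|m [s [us s0 ss]]]; first by exists [::].
  have : 'X * \prod_(z <- s) ('X - z%:P) != 0 :> {poly K}.
    by rewrite mulf_neq0 ?polyX_eq0 // monic_neq0 // monic_prod_XsubC.
  case/closed_nonrootP => z; rewrite rootM rootX root_prod_XsubC negb_or => /andP[z0 zs].
  by exists (z :: s); rewrite /= zs us ss inE negb_or eq_sym z0 s0.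
exists (nth 0 s); split => [i | i j]; rewrite -ss => im.
  by apply: contraNneq s0 => <-; rewrite mem_nth.
by move=> jm /eqP; rewrite nth_uniq // => /eqP.
Qed.

(** * Two recurrences for block entries *)

Section Recurrences.
Variables (K : fieldType) (m : nat) (lam : nat -> nat) (X : nat -> nat -> nat -> K).

(* [X i k p] stands for [v_i x e^p psi_k] with [x] commuting with [e]. *)
Definition shift_term l k D : K :=
  (if l is l'.+1 then X l' k (D - lam l) else 0) -
  (if (k.+1 < m)%N then X l k.+1 (D - lam k) else 0).

(** The shift terms belong to pairs with smaller [l - k], so they vanish by induction. For fixed
    [l, k] one descends on [p]: if the lengths differ, a suitable [D] relates the entry at [p] to
    one at a larger argument; if they agree, [a l != a k] decides. *)
Lemma diagonal_recurrence (a : nat -> K) (t : K) :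
  (forall i, (i < m)%N -> a i != 0) ->
  (forall i j, (i < m)%N -> (j < m)%N -> a i = a j -> i = j) ->
  (forall l k p, (l < m)%N -> (k < m)%N -> (lam k <= p)%N -> X l k p = 0) ->
  (forall i p, (i < m)%N -> X i i p = 0) ->
  (forall l k D, (l < m)%N -> (k < m)%N -> l != k -> (lam l <= D)%N -> (lam k <= D)%N ->
    a l * X l k (D - lam l) - a k * X l k (D - lam k) + t * shift_term l k D = 0) ->
  forall l k p, (l < m)%N -> (k < m)%N -> X l k p = 0.
Proof.
move=> a0 ainj Xlarge Xdiag H l k.
have [s] := ubnP (l + (m - k)); elim: s => // s IH in l k *.
rewrite ltnS => hs p lm km.
have [-> | lk] := eqVneq l k; first exact: Xdiag.
have E D : (lam l <= D)%N -> (lam k <= D)%N -> a l * X l k (D - lam l) = a k * X l k (D - lam k).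
  move=> lD kD; have := H l k D lm km lk lD kD.
  have -> : shift_term l k D = 0.
    rewrite /shift_term; have -> : (if l is l'.+1 then X l' k (D - lam l) else 0) = 0.
      by case: l lm hs {H lk lD} => // l' lm hs; apply: IH; lia.
    by case: ifP => [k1 | _]; rewrite ?subrr // IH ?subrr //; lia.
  by rewrite mulr0 addr0 => /eqP; rewrite subr_eq0 => /eqP.
have [q] := ubnP (lam k - p); elim: q => // q IHq in p *; rewrite ltnS => hq.
have [le | gt] := leqP (lam k) p; first exact: Xlarge.
case: (ltngtP (lam l) (lam k)) => [lt | lt | eq].
- have := E (lam k + p)%N; rewrite addKn (IHq (lam k + p - lam l)%N) ?mulr0; last by lia.
  move=> /(_ (leq_trans (ltnW lt) (leq_addr _ _)) (leq_addr _ _)) /esym/eqP.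
  by rewrite mulf_eq0 (negPf (a0 k km)) => /eqP.
- have := E (lam l + p)%N; rewrite addKn (IHq (lam l + p - lam k)%N) ?mulr0; last by lia.
  move=> /(_ (leq_addr _ _) (leq_trans (ltnW lt) (leq_addr _ _))) /eqP.
  by rewrite mulf_eq0 (negPf (a0 l lm)) => /eqP.
have := E (lam k + p)%N; rewrite eq addKn => /(_ (leq_addr _ _) (leq_addr _ _)) /eqP.
rewrite -subr_eq0 -mulrBl mulf_eq0 subr_eq0 => /orP[/eqP /(ainj l k lm km) E' | /eqP //].
by rewrite E' eqxx in lk.
Qed.

(** The relations link entries with the same [l - k]. Above the diagonal, both indices increase
    until [k] leaves the range; otherwise both decrease until [k = 0]. Monotonicity of [lam] makes
    the required [D] admissible. *)
Lemma shift_recurrence :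
  (forall i j, (i <= j)%N -> (j < m)%N -> (lam j <= lam i)%N) ->
  (forall l p, (l < m)%N -> X l 0%N p = 0) ->
  (forall l k D, (l < m)%N -> (k < m)%N -> (lam l <= D)%N -> (lam k <= D)%N ->
    shift_term l k D = 0) ->
  forall l k p, (l < m)%N -> (k < m)%N -> X l k p = 0.
Proof.
move=> dec X0 H.
have upper l k p : (l < k)%N -> (k < m)%N -> X l k p = 0.
  have [s] := ubnP (m - k); elim: s => // s IH in l k p *; rewrite ltnS => hs lk km.
  have := H l.+1 k (lam l.+1 + p)%N (leq_ltn_trans lk km) km (leq_addr _ _).
  move=> /(_ (leq_trans (dec _ _ lk km) (leq_addr _ _))); rewrite /shift_term addKn.
  move/eqP; rewrite subr_eq0 => /eqP ->; case: ifP => // k1; apply: IH => //; lia.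
move=> l k; elim: k => [|k IH] in l * => p lm km; first exact: X0.
have [lt | ge] := ltnP l k.+1; first exact: upper.
have km' := ltnW km; have := H l k (lam k + p)%N lm km'.
move=> /(_ (leq_trans (dec _ _ (ltnW ge) lm) (leq_addr _ _)) (leq_addr _ _)).
rewrite /shift_term addKn km => /eqP; rewrite subr_eq0 => /eqP <-.
by case: l lm ge => // l lm ge; apply: IH => //; apply: ltnW.
Qed.

End Recurrences.

(** * Trace functionals and Gram determinants *)

Section Forms.
Variables (K : fieldType) (n : nat) (e : 'M[K]_n).
Notation ge := (subvs_of (centraliser e)).

Definition trace_form (f : 'M[K]_n) (x : ge) : K^o := \tr (f *m vsval x).
Fact trace_form_linear f : linear (trace_form f).
Proof. by move=> a x y; rewrite /trace_form !linearP. Qed.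
HB.instance Definition _ f :=
  GRing.isLinear.Build K ge K^o *:%R (trace_form f) (trace_form_linear f).

Definition trace_functional (f : 'M[K]_n) : dual_ge e := linfun (trace_form f).

Lemma trace_functionalE f x : trace_functional f x = \tr (f *m vsval x).
Proof. by rewrite lfunE. Qed.

Definition gram r (u : r.-tuple ge) (gamma : dual_ge e) : 'M[K]_r :=
  \matrix_(i, j) gamma (bracket u`_i u`_j).
Fact gram_linear r (u : r.-tuple ge) : linear (gram u).
Proof.
by move=> a x y; apply/matrixP => i j; rewrite !mxE add_lfunE scale_lfunE.
Qed.
HB.instance Definition _ r u :=
  GRing.isLinear.Build K (dual_ge e) 'M[K]_r *:%R (@gram r u) (@gram_linear r u).

Lemma mulmx_gram r (u : r.-tuple ge) gamma (c : 'rV[K]_r) j :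
  (c *m gram u gamma) 0 j = gamma (bracket (\sum_i c 0 i *: u`_i) u`_j).
Proof.
rewrite bracketC linear_sum /= -sumrN linear_sum mxE; apply: eq_bigr => i _.
by rewrite linearZ /= -scalerN -bracketC linearZ mxE.
Qed.

Lemma det_gram_neq0 r (u : r.-tuple ge) (U : {vspace ge}) (gamma : dual_ge e) : basis_of U u ->
  (forall x, x \in U -> (forall y, y \in U -> gamma (bracket x y) = 0) -> x = 0) ->
  \det (gram u gamma) != 0.
Proof.
move=> uU nondeg; rewrite -unitfE -unitmxE -row_free_unit; apply: inj_row_free => c cG.
pose x := \sum_i c 0 i *: u`_i.
have uiU (i : 'I_r) : u`_i \in U by apply: (basis_mem uU); rewrite mem_nth ?size_tuple.
have x0 : x = 0.
  apply: nondeg => [|y yU]; first by apply: rpred_sum => i _; apply: rpredZ.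
  rewrite (coord_basis uU yU) !linear_sum big1 // => j _ /=.
  by rewrite !linearZ /= -mulmx_gram cG mxE scaler0.
apply/rowP => i; rewrite mxE.
by have /freeP := basis_free uU; apply.
Qed.

(** By dimension the span of [u] meets the stabiliser, and a common nonzero vector gives a left
    kernel vector of the Gram matrix. *)
Lemma det_gram_eq0 r (u : r.-tuple ge) (gamma : dual_ge e) : free u ->
  (\dim {: ge} < r + \dim (stab gamma))%N -> \det (gram u gamma) = 0.
Proof.
move=> fu lt; apply/eqP/det0P.
have : (<<u>> :&: stab gamma)%VS != 0%VS.
  rewrite -dimv_eq0 -lt0n -(ltn_add2l (\dim (<<u>> + stab gamma))) addn0 dimv_sum_cap.
  move: fu; rewrite /free size_tuple => /eqP ->.
  exact: leq_ltn_trans (dimvS (subvf _)) lt.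
set V := (_ :&: _)%VS => V0; have := memv_pick V.
rewrite memv_cap => /andP[]; set x := vpick V => xu /mem_stab xs.
exists (\row_i coord u i x).
  apply: contra_neq V0 => c0; apply/eqP; rewrite -vpick0 -/x (coord_span xu).
  by rewrite big1 // => i _; have := congr1 (fun c : 'rV_r => c 0 i) c0;
    rewrite !mxE => ->; rewrite scale0r.
apply/rowP => j; rewrite mulmx_gram mxE -[RHS](xs u`_j); congr (gamma (bracket _ _)).
by rewrite [RHS](coord_span xu); apply: eq_bigr => i _; rewrite mxE.
Qed.

End Forms.

(** * The plane spanned by the diagonal and shifted functionals *)

Section RegularPlane.
Variables (K : fieldType) (n : nat) (e : 'M[K]_n) (m : nat) (lam : nat -> nat).
Variables (v : nat -> 'rV[K]_n) (psi : nat -> 'cV[K]_n).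
Hypothesis J : jordan_system e m lam v psi.
Hypothesis rest0 : rest_proj e m lam v psi = 0.
Notation ge := (subvs_of (centraliser e)).

Definition block_entry (x : 'M[K]_n) i k p : K := (v i *m x *m (e ^+ p *m psi k)) 0 0.

Lemma centraliser_expr (x : 'M[K]_n) p : x \in centraliser e -> x *m e ^+ p = e ^+ p *m x.
Proof.
rewrite mem_centraliser => /eqP xe; elim: p => [|p IH]; first by rewrite mulmx1 mul1mx.
by rewrite exprmxS mulmxA xe -!mulmxA IH.
Qed.

Lemma block_entry_large (x : 'M[K]_n) i k p : (k < m)%N -> (lam k <= p)%N -> block_entry x i k p = 0.
Proof. by move=> km le; rewrite /block_entry (col_nilp J km le) mulmx0 mxE. Qed.

Lemma block_entry_shift (x : 'M[K]_n) i k p s : x \in centraliser e ->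
  v i *m e ^+ s *m x *m (e ^+ p *m psi k) = (block_entry x i k (s + p))%:M.
Proof.
move=> xe; rewrite [LHS]mx11_scalar /block_entry exprmxD -(mulmxA (v i) _ x).
by rewrite -centraliser_expr // !mulmxA.
Qed.

Lemma sum_block_proj : \sum_(i < m) block_proj e lam v psi i = 1%:M.
Proof. by apply/esym/eqP; rewrite -subr_eq0; apply/eqP. Qed.

(** Put the identity, decomposed into block projections, on both sides of [x]; every resulting term
    contains a block entry. *)
Lemma block_entry_inj (x : 'M[K]_n) : x \in centraliser e ->
  (forall i k p, (i < m)%N -> (k < m)%N -> block_entry x i k p = 0) -> x = 0.
Proof.
move=> xe X0; rewrite -[x]mulmx1 -[x]mul1mx -sum_block_proj !mulmx_suml big1 // => i _.
rewrite mulmx_sumr big1 // => k _; rewrite /block_proj /chain_mx !mulmx_suml.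
rewrite big1 // => a _; rewrite mulmx_sumr big1 // => b _.
have E (A C : 'cV[K]_n) (B D : 'rV[K]_n) : B *m x *m C = 0 -> A *m B *m x *m (C *m D) = 0.
  by move=> E; rewrite -(mulmxA A B x) mulmxA -(mulmxA A _ C) E mulmx0 mul0mx.
by apply: E; rewrite block_entry_shift // X0 // raddf0.
Qed.

(** These elements of the centraliser are the test vectors [y] in [gamma([x, y])]. *)
Definition chain_elt d k l := chain_mx e d (psi k) (v l).

Lemma chain_elt_centraliser d k l : (k < m)%N -> (l < m)%N ->
  (lam k <= d.+1)%N -> (lam l <= d.+1)%N -> chain_elt d k l \in centraliser e.
Proof.
move=> km lm kd ld; rewrite mem_centraliser; apply/eqP; apply: chain_mx_comm.
  exact: (col_nilp J km kd).
exact: (row_nilp J lm ld).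
Qed.

(** The trace against [psi j *m v i] is evaluation between [v i] and [psi j]; [chain_mx_col] and
    [row_chain_mx] with [s = 0] evaluate the two products. *)
Lemma lie_chain_elt (x : 'M[K]_n) d k l i j : x \in centraliser e ->
  (k < m)%N -> (l < m)%N -> (i < m)%N -> (j < m)%N ->
  (lam k <= d.+1)%N -> (lam l <= d.+1)%N ->
  \tr (psi j *m v i *m lie x (chain_elt d k l)) =
  (j == l)%:R * block_entry x i k (d.+1 - lam l) -
  (i == k)%:R * block_entry x l j (d.+1 - lam k).
Proof.
move=> xe km lm im jm kd ld.
rewrite -mulmxA mxtrace_mulC /lie mulmxBr mulmxBl [LHS]trace_mx11 mxE [X in _ + X]mxE.
congr (_ - _).
  have := chain_mx_col J 0 jm lm ld (col_nilp J km kd).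
  rewrite mul1mx addn1 -(mulmxA (v i)) -(mulmxA x) => ->.
  by rewrite -!scalemxAr mxE mulmxA.
have := row_chain_mx J 0 im km kd (row_nilp J lm ld).
rewrite mulmx1 addn1 mulmxA => ->; rewrite -!scalemxAl mxE; congr (_ * _).
have := block_entry_shift l j 0 (d.+1 - lam k) xe; rewrite mul1mx addn0 => ->.
by rewrite mxE eqxx mulr1n.
Qed.

(** The trace forms of this matrix and of [super_form] are the functionals [alpha] and [beta]. *)
Definition diag_form (a : nat -> K) := \sum_(i < m) a i *: (psi i *m v i).
Definition super_form := \sum_(i < m.-1) psi i.+1 *m v i.

Lemma diag_form_lie a x d k l : x \in centraliser e -> (k < m)%N -> (l < m)%N ->
  (lam k <= d.+1)%N -> (lam l <= d.+1)%N ->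
  \tr (diag_form a *m lie x (chain_elt d k l)) =
  a l * block_entry x l k (d.+1 - lam l) - a k * block_entry x l k (d.+1 - lam k).
Proof.
move=> xe km lm kd ld; rewrite /diag_form mulmx_suml linear_sum /=.
under eq_bigr => i _ do rewrite -scalemxAl linearZ /= lie_chain_elt //.
under eq_bigr => i _ do rewrite mulrBr.
rewrite big_split /= sumrN; congr (_ - _).
  rewrite (bigD1 (Ordinal lm)) //= eqxx mul1r big1 ?addr0 // => i ne.
  have -> : (i == l :> nat) = false by apply/negbTE.
  by rewrite mul0r mulr0.
rewrite (bigD1 (Ordinal km)) //= eqxx mul1r big1 ?addr0 // => i ne.
have -> : (i == k :> nat) = false by apply/negbTE.
by rewrite mul0r mulr0.
Qed.

Lemma super_form_lie x d k l : x \in centraliser e -> (k < m)%N -> (l < m)%N ->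
  (lam k <= d.+1)%N -> (lam l <= d.+1)%N ->
  \tr (super_form *m lie x (chain_elt d k l)) = shift_term m lam (block_entry x) l k d.+1.
Proof.
move=> xe km lm kd ld; rewrite /super_form mulmx_suml linear_sum /=.
have im (i : 'I_m.-1) : (i.+1 < m)%N by have := ltn_ord i; lia.
under eq_bigr => i _ do rewrite lie_chain_elt // 1?ltnW //.
rewrite big_split /= sumrN /shift_term; congr (_ - _).
  case: l lm ld => [|l] lm ld.
    by rewrite big1 // => i _; rewrite mul0r.
  have lm' : (l < m.-1)%N by lia.
  rewrite (bigD1 (Ordinal lm')) //= eqxx mul1r big1 ?addr0 // => i ne.
  have -> : (i.+1 == l.+1) = false by apply/negbTE.
  by rewrite mul0r.
case: ifP => [k1 | k1].
  have km' : (k < m.-1)%N by lia.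
  rewrite (bigD1 (Ordinal km')) //= eqxx mul1r big1 ?addr0 // => i ne.
  have -> : (i == k :> nat) = false by apply/negbTE.
  by rewrite mul0r.
rewrite big1 // => i _; have -> : (i == k :> nat) = false.
  by apply/eqP => ik; have := im i; rewrite ik k1.
by rewrite mul0r.
Qed.

(** The summands lie in different blocks, so a single row of [n] entries records all diagonal
    blocks. *)
Definition block_diag (x : ge) : 'rV[K]_n := \sum_(i < m) v i *m vsval x *m block_proj e lam v psi i.
Fact block_diag_linear : linear block_diag.
Proof.
move=> a x y; rewrite /block_diag scaler_sumr -big_split /=; apply: eq_bigr => i _.
by rewrite mulmxDr mulmxDl -scalemxAr -scalemxAl.
Qed.
HB.instance Definition _ :=
  GRing.isLinear.Build K ge 'rV[K]_n *:%R block_diag block_diag_linear.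

Definition off_diag : {vspace ge} := lker (linfun block_diag).

Lemma off_diag_entry x i p : x \in off_diag -> (i < m)%N -> block_entry (vsval x) i i p = 0.
Proof.
rewrite memv_ker lfunE /= => /eqP x0 im.
have : block_diag x *m (e ^+ p *m psi i) = 0 by rewrite x0 mul0mx.
rewrite mulmx_suml (bigD1 (Ordinal im)) //= big1 => [|k ne].
  rewrite -mulmxA (block_proj_col J) // eqxx scale1r addr0 => E.
  by rewrite /block_entry E mxE.
rewrite -mulmxA (block_proj_col J) //.
have -> : (i == k) = false by apply/negbTE; rewrite eq_sym.
by rewrite scale0r mulmx0.
Qed.

Lemma chain_elt_off_diag d k l : (k < m)%N -> (l < m)%N -> k != l ->
  (lam k <= d.+1)%N -> (lam l <= d.+1)%N -> vsproj (centraliser e) (chain_elt d k l) \in off_diag.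
Proof.
move=> km lm kl kd ld; rewrite memv_ker lfunE /= /block_diag.
rewrite vsprojK ?chain_elt_centraliser // big1 // => i _.
have := row_chain_mx J 0 (ltn_ord i) km kd (row_nilp J lm ld); rewrite mulmx1 => ->.
rewrite -scalemxAl (row_block_proj J) //; case: eqVneq => [-> | _]; last by rewrite scale0r.
by rewrite eq_sym (negPf kl) scale0r scaler0.
Qed.

(** Testing against [chain_elt d k l] with [k != l] gives exactly the relations of
    [diagonal_recurrence]. *)
Lemma off_diag_nondegenerate a t :
  (forall i, (i < m)%N -> a i != 0) ->
  (forall i j, (i < m)%N -> (j < m)%N -> a i = a j -> i = j) ->
  forall x, x \in off_diag ->
   (forall y, y \in off_diag ->
     (trace_functional e (diag_form a) + t *: trace_functional e super_form) (bracket x y) = 0) ->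
   x = 0.
Proof.
move=> a0 ainj x xU H; have xe := subvsP x.
apply: val_inj; apply: (block_entry_inj xe).
apply: (diagonal_recurrence (lam := lam) (t := t) a0 ainj).
- by move=> l k p lm km; apply: block_entry_large.
- by move=> i p; apply: off_diag_entry.
(* [D = 0] is impossible because [lam l] is positive, so [D = d.+1]. *)
move=> l k [|d] lm km lk ld kd; first by move: (js_pos J lm); rewrite ltnNge ld.
have := H _ (chain_elt_off_diag km lm _ kd ld); rewrite eq_sym lk => /(_ isT).
rewrite add_lfunE scale_lfunE !trace_functionalE vsval_bracket vsprojK ?chain_elt_centraliser //.
by rewrite diag_form_lie // super_form_lie.
Qed.

Lemma dim_off_diag : (\dim {: ge} <= \dim off_diag + n)%N.
Proof.
have := limg_ker_dim (linfun block_diag) fullv; rewrite capfv => <-.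
rewrite leq_add2l; apply: leq_trans (dimvS (subvf _)) _.
by rewrite dimvf /dim /= mul1n.
Qed.

(** On the stabiliser the test vectors give the relations of [shift_recurrence]; [x psi_0 = 0]
    supplies its initial condition, so [x |-> x psi_0] is injective there. *)
Lemma dim_stab_super_form : (0 < m)%N -> (\dim (stab (trace_functional e super_form)) <= n)%N.
Proof.
move=> m0; pose h (x : ge) : 'cV[K]_n := vsval x *m psi 0%N.
have h_lin : linear h by move=> a x y; rewrite /h linearP mulmxDl -scalemxAl.
pose H : {linear ge -> 'cV[K]_n} := HB.pack h (GRing.isLinear.Build _ _ _ _ h h_lin).
set S := stab _; have := limg_ker_dim (linfun H) S.
have -> : (S :&: lker (linfun H) = 0)%VS.
  apply/eqP; rewrite -subv0; apply/subvP => x; rewrite memv_cap memv0.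
  move=> /andP[/mem_stab xS]; rewrite memv_ker lfunE /= => /eqP hx; have xe := subvsP x.
  rewrite -(inj_eq val_inj); apply/eqP; apply: (block_entry_inj xe).
  apply: (shift_recurrence (js_dec J)).
    move=> l p lm; rewrite /block_entry mulmxA -(mulmxA (v l)) centraliser_expr //.
    by rewrite -!mulmxA [vsval x *m _]hx !mulmx0 mxE.
  move=> l k [|d] lm km ld kd; first by move: (js_pos J lm); rewrite ltnNge ld.
  have := xS (vsproj (centraliser e) (chain_elt d k l)).
  rewrite trace_functionalE vsval_bracket vsprojK ?chain_elt_centraliser //.
  by rewrite super_form_lie.
rewrite dimv0 add0n => <-; apply: leq_trans (dimvS (subvf _)) _.
by rewrite dimvf /dim /= muln1.
Qed.

End RegularPlane.

(** * Assembly of the codimension bound *)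

Lemma tuple_basis (K : fieldType) (W : vectType K) (U : {vspace W}) r : \dim U = r ->
  exists u : r.-tuple W, basis_of U u.
Proof. by move=> <-; exists (vbasis U); apply: vbasisP. Qed.

Lemma dim_dual_ge (K : fieldType) n (e : 'M[K]_n) :
  \dim {: dual_ge e} = \dim {: subvs_of (centraliser e)}.
Proof. by rewrite !dimvf /dim /= muln1. Qed.

(** The constant [1] vanishes on the empty set, so its closure is empty, whereas irreducible sets
    have points. *)
Lemma zdim_le_empty (K : fieldType) (W : vectType K) (X : W -> Prop) d :
  (forall w, ~ X w) -> zdim_le X d.
Proof.
move=> X0 k Z irr _ ZX; have [_ [[w Zw] _]] := irr k (leqnn k).
have := ZX w Zw 1; rewrite /polyfun meval1 => /(_ (fun x Xx => False_ind _ (X0 x Xx))).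
by move/eqP; rewrite oner_eq0.
Qed.

Theorem theorem3p4 (K : closedFieldType) (n : nat) (hn : (2 <= n)%N)
  (e : 'M[K]_n) (he : exists k : nat, e ^+ k = 0) :
  zcodim_ge (@sing K n e) 2.
Proof.
pose N : nat := \dim {: subvs_of (centraliser e)}.
have stabN (gamma : dual_ge e) : (\dim (stab gamma) <= N)%N by apply/dimvS/subvf.
have nN : (n <= N)%N := leq_trans (dim_stab_ge (0 : dual_ge e)) (stabN _).
have sing_stab (gamma : dual_ge e) : sing gamma -> (n < \dim (stab gamma))%N.
  by case=> gamma' lt; apply: leq_ltn_trans lt; exact: (dim_stab_ge gamma').
split; first by rewrite dim_dual_ge; apply: leq_trans nN.
(* If [N = n], no stabiliser can exceed dimension [n] and the singular set is empty; otherwise the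
   Gram matrices have positive size. *)
have [r0 | rpos] := posnP (N - n)%N.
  by apply: zdim_le_empty => gamma /sing_stab; have := stabN gamma; lia.
have [m [lam [v [psi [J rest0]]]]] := jordan_system_exists he.
have m0 : (0 < m)%N.
  rewrite lt0n; apply/eqP => m0; move: rest0; rewrite /rest_proj m0 big_ord0 subr0.
  case: n hn {e he N stabN nN sing_stab rpos v psi J} => // n' _ /matrixP /(_ 0 0) /eqP.
  by rewrite !mxE oner_eq0.
have [a [a0 ainj]] := distinct_nonzero K m.
pose alpha := trace_functional e (diag_form m v psi a).
pose beta := trace_functional e (super_form m v psi).
have nondeg t := off_diag_nondegenerate J rest0 (a := a) (t := t) a0 ainj.
pose U := off_diag e m lam v psi : {vspace subvs_of (centraliser e)}.
have dimU : \dim U = (N - n)%N.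
  apply/eqP; rewrite eqn_leq; apply/andP; split; last first.
    by rewrite leq_subLR addnC; apply: dim_off_diag.
  (* A larger [U] would have a Gram determinant that is nonzero by nondegeneracy yet zero by
     Vinberg's inequality. *)
  rewrite leqNgt; apply/negP => lt.
  have [u uU] := tuple_basis (erefl (\dim U)).
  have /eqP[] := det_gram_neq0 uU (nondeg 0).
  apply: det_gram_eq0 (basis_free uU) _.
  apply: leq_trans (leq_add lt (dim_stab_ge _)).
  by rewrite addSn subnK.
have [u uU] := tuple_basis dimU.
have dimS : \dim (stab beta) = n.
  by apply/eqP; rewrite eqn_leq dim_stab_ge (dim_stab_super_form J rest0 m0).
have dimC : \dim (stab beta)^C = (N - n)%N by rewrite dimv_compl dimS.
have [w wC] := tuple_basis dimC.
rewrite /zcodim_ge; apply: (codim2_of_determinants (r := N - n) (A := gram u)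
   (B := gram w) (x := alpha) (y := beta)) => //.
- by move=> t; apply: det_gram_neq0 uU (nondeg t).
(* The form of [beta] is nondegenerate on any complement of its stabiliser. *)
- apply: det_gram_neq0 wC _ => x xC H.
  apply/eqP; rewrite -memv0 -(capv_compl (stab beta)) memv_cap xC andbT.
  apply/mem_stab => y; have : y \in (stab beta + (stab beta)^C)%VS by rewrite addv_complf memvf.
  case/memv_addP => y1 /mem_stab y1S [y2 y2C ->].
  by rewrite linearD linearD /= (H y2 y2C) addr0 bracketC linearN /= y1S oppr0.
move=> gamma /sing_stab lt.
(* A stabiliser of dimension above [n] forces every Gram determinant of size [N - n] to vanish. *)
have lt' : (N < N - n + \dim (stab gamma))%N by lia.
by split; apply: det_gram_eq0 => //; [apply: basis_free uU | apply: basis_free wC].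
Qed.
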